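(* The center $Z(\mathfrak{s})$ of the universal enveloping algebra $U(\mathfrak{s})$ of the Schrödinger algebra is $Z(\mathfrak{s})=\mathbb{C}[z,\mathtt{c}]$, the subalgebra generated by $z$ and $\mathtt{c}$.
   Context: The Schrödinger algebra $\mathfrak{s}$ is the complex Lie algebra with basis $e,h,f,p,q,z$, with $z$ central and the remaining brackets $[h,e]=2e$, $[e,f]=h$, $[h,f]=-2f$, $[e,q]=p$, $[e,p]=0$, $[h,p]=p$, $[f,p]=q$, $[f,q]=0$, $[h,q]=-q$, $[p,q]=z$. The element $\mathtt{c}\in U(\mathfrak{s})$ is $\mathtt{c}=(h^2+h+4fe)z-2(fp^2-eq^2-hpq)$. *)

(* Defs.v *)
From HB Require Import structures.
From mathcomp Require Import all_boot all_order all_algebra.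
From mathcomp Require Import generic_quotient ring_quotient.
From mathcomp Require Import boolp classical_sets reals.
From mathcomp Require Import complex.
From mathcomp Require Import finmap monalg.
From mathcomp Require Import ring.

Set Implicit Arguments.
Unset Strict Implicit.
Unset Printing Implicit Defensive.

Import GRing.Theory.

Local Open Scope ring_scope.
Local Open Scope quotient_scope.

HB.mixin Record Lmodule_isLieAlgebra (K : fieldType) L of GRing.Lmodule K L := {
  lie : L -> L -> L;
  lie_linearl : forall (a : K) x1 x2 y,
    lie (a *: x1 + x2) y = a *: lie x1 y + lie x2 y;
  lie_linearr : forall (a : K) x y1 y2,
    lie x (a *: y1 + y2) = a *: lie x y1 + lie x y2;
  lie_alternating : forall x, lie x x = 0;
  lie_jacobi : forall x y z,
    lie x (lie y z) + lie y (lie z x) + lie z (lie x y) = 0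
}.

#[short(type="lieAlgType")]
HB.structure Definition LieAlgebra (K : fieldType) :=
  {L of GRing.Lmodule K L & Lmodule_isLieAlgebra K L}.

(* U(L) is the quotient of the free associative unital K-algebra on the set L
   by the two-sided ideal generated by the relations making L -> U(L) linear
   (which turn the free algebra on the set L into the tensor algebra T(L)) and
   by the relations [x, y] = x y - y x.  {malg K[fmonom L]} is the monoid
   algebra of the free monoid of words over L, i.e. the free algebra on L. *)
Section Enveloping.
Variables (K : fieldType) (L : lieAlgType K).

Local Notation F := {malg K[fmonom L]}.

Definition env_gen (x : L) : F := << fmu x >>.

Variant env_relator : F -> Prop :=
| env_relator_linear (a : K) (x y : L) :
    env_relator (env_gen (a *: x + y) - (a *: env_gen x + env_gen y))
| env_relator_lie (x y : L) :
    env_relator (env_gen (lie x y)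
                 - (env_gen x * env_gen y - env_gen y * env_gen x)).

Definition two_sided_ideal (J : F -> Prop) : Prop :=
  [/\ J 0, forall u v, J u -> J v -> J (u - v)
         & forall a b u, J u -> J (a * u * b)].

Definition env_ideal : pred F := fun u =>
  `[< forall J : F -> Prop,
        two_sided_ideal J -> (forall r, env_relator r -> J r) -> J u >].

Lemma env_idealP u :
  reflect (forall J : F -> Prop,
        two_sided_ideal J -> (forall r, env_relator r -> J r) -> J u)
    (u \in env_ideal).
Proof. exact: asboolP. Qed.

Lemma env_ideal_zmod_closed : zmod_closed env_ideal.
Proof.
split; first by apply/env_idealP => J [].
move=> u v /env_idealP Ju /env_idealP Jv; apply/env_idealP => J idJ relJ.
by case: (idJ) => _ JB _; apply: JB; [apply: Ju | apply: Jv].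
Qed.

HB.instance Definition _ := GRing.isZmodClosed.Build F env_ideal
  env_ideal_zmod_closed.

Lemma env_idealMM a b u : u \in env_ideal -> a * u * b \in env_ideal.
Proof.
move=> /env_idealP Ju; apply/env_idealP => J idJ relJ.
by case: (idJ) => _ _ JM; apply: JM; apply: Ju.
Qed.

Lemma env_idealMl a u : u \in env_ideal -> a * u \in env_ideal.
Proof. by move/(env_idealMM a 1); rewrite mulr1. Qed.

Lemma env_idealMr b u : u \in env_ideal -> u * b \in env_ideal.
Proof. by move/(env_idealMM 1 b); rewrite mul1r. Qed.

Lemma env_relatorW r : env_relator r -> r \in env_ideal.
Proof. by move=> relr; apply/env_idealP => J _; apply. Qed.

Section FreeLift.
Variables (A : algType K) (f : L -> A).

Definition word_eval (m : fmonom L) : A := \prod_(x <- (m : seq L)) f x.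

Lemma word_eval_is_mmorphism : mmorphism word_eval.
Proof.
split; last by rewrite /word_eval fm1 big_nil.
by move=> m1 m2; rewrite /word_eval fmM big_cat.
Qed.

HB.instance Definition _ :=
  isMultiplicative.Build (fmonom L) A word_eval word_eval_is_mmorphism.

Definition free_lift : F -> A := mmap (in_alg A) word_eval.

Lemma free_lift_is_monoid_morphism : monoid_morphism free_lift.
Proof.
have [] := @commr_mmap_is_multiplicative _ _ _ (in_alg A) word_eval.
  by move=> g m m'; rewrite /GRing.comm /= -scalerAl -scalerAr mul1r mulr1.
by move=> fM f1; split.
Qed.

Lemma free_liftM u v : free_lift (u * v) = free_lift u * free_lift v.
Proof. by case: free_lift_is_monoid_morphism => _; apply. Qed.

Lemma free_lift1 : free_lift 1 = 1.
Proof. by case: free_lift_is_monoid_morphism. Qed.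

Lemma free_liftB u v : free_lift (u - v) = free_lift u - free_lift v.
Proof. exact: mmapB. Qed.

Lemma free_liftD u v : free_lift (u + v) = free_lift u + free_lift v.
Proof. exact: mmapD. Qed.

Lemma free_liftZ a u : free_lift (a *: u) = a *: free_lift u.
Proof. by rewrite /free_lift mmapZ /= -scalerAl mul1r. Qed.

Lemma free_lift_gen x : free_lift (env_gen x) = f x.
Proof. by rewrite /free_lift mmapU /= scale1r mul1r /word_eval fmU big_seq1. Qed.

Hypothesis f_lin : linear f.
Hypothesis f_lie : forall x y, f (lie x y) = f x * f y - f y * f x.

Lemma free_lift_ideal u : u \in env_ideal -> free_lift u = 0.
Proof.
move=> /env_idealP/(_ (fun u => free_lift u = 0)); apply.
  split=> [|v w v0 w0|a b v v0]; first exact: mmap0.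
    by rewrite free_liftB v0 w0 subr0.
  by rewrite !free_liftM v0 mulr0 mul0r.
move=> _ [a x y|x y]; rewrite free_liftB.
  by rewrite free_liftD free_liftZ !free_lift_gen f_lin subrr.
apply/eqP; rewrite subr_eq0 free_lift_gen f_lie; apply/eqP.
rewrite free_liftB; congr (_ - _).
  by rewrite free_liftM !free_lift_gen.
by rewrite free_liftM !free_lift_gen.
Qed.

End FreeLift.

Definition env_alg : Type := 
  Quotient.quot (GRing.ZmodClosed.clone F env_ideal _).

HB.instance Definition _ := GRing.Zmodule.on env_alg.
HB.instance Definition _ := EqQuotient.on env_alg.

Local Notation U := env_alg.

Lemma env_pi_eq u v : (\pi_U u = \pi_U v) <-> (u - v \in env_ideal).
Proof. by rewrite Quotient.idealrBE; split=> /eqP. Qed.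

Lemma env_pi_ind (P : U -> Prop) : (forall u, P (\pi_U u)) -> forall x, P x.
Proof. by move=> Ppi x; rewrite -[x]reprK. Qed.

Lemma env_piD u v : \pi_U (u + v) = \pi_U u + \pi_U v.
Proof. exact: Quotient.pi_add. Qed.

Lemma env_piB u v : \pi_U (u - v) = \pi_U u - \pi_U v.
Proof. by rewrite env_piD; congr (_ + _); apply: Quotient.pi_opp. Qed.

Definition env_one : U := \pi_U 1.
Definition env_mul (x y : U) : U := \pi_U (repr x * repr y).
Definition env_scale (a : K) (x : U) : U := \pi_U (a *: repr x).

Lemma env_reprB u : repr (\pi_U u) - u \in env_ideal.
Proof. by apply/env_pi_eq; rewrite reprK. Qed.

Lemma env_piM u v : \pi_U (u * v) = env_mul (\pi_U u) (\pi_U v).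
Proof.
apply/esym/env_pi_eq; pose u' := repr (\pi_U u); pose v' := repr (\pi_U v).
rewrite -/u' -/v'.
have -> : u' * v' - u * v = u' * (v' - v) + (u' - u) * v.
  by rewrite mulrBr mulrBl addrA subrK.
apply: rpredD; first by apply: env_idealMl; apply: env_reprB.
by apply: env_idealMr; apply: env_reprB.
Qed.

Lemma malgC_comm (a : K) (u : F) : u * a%:MP = a%:MP * u.
Proof.
rewrite mul_malgC malgM_def malgZ_def fgmulgU; apply: eq_bigr => /= m _.
by rewrite mulm1 mulrC.
Qed.

Lemma malgZAr (a : K) (u v : F) : a *: (u * v) = u * (a *: v).
Proof. by rewrite -!mul_malgC !mulrA malgC_comm. Qed.

Lemma env_piZ a u : \pi_U (a *: u) = env_scale a (\pi_U u).
Proof.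
by apply/esym/env_pi_eq; rewrite -scalerBr -mul_malgC env_idealMl ?env_reprB.
Qed.

Lemma env_mulA : associative env_mul.
Proof.
by elim/env_pi_ind=> x; elim/env_pi_ind=> y; elim/env_pi_ind=> z;
  rewrite -!env_piM mulrA.
Qed.

Lemma env_mul1 : left_id env_one env_mul.
Proof. by elim/env_pi_ind=> x; rewrite -env_piM mul1r. Qed.

Lemma env_mulr1 : right_id env_one env_mul.
Proof. by elim/env_pi_ind=> x; rewrite -env_piM mulr1. Qed.

Lemma env_mulDl : left_distributive env_mul +%R.
Proof.
by elim/env_pi_ind=> x; elim/env_pi_ind=> y; elim/env_pi_ind=> z;
  rewrite -env_piD -!env_piM -env_piD mulrDl.
Qed.

Lemma env_mulDr : right_distributive env_mul +%R.
Proof.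
by elim/env_pi_ind=> x; elim/env_pi_ind=> y; elim/env_pi_ind=> z;
  rewrite -env_piD -!env_piM -env_piD mulrDr.
Qed.

Lemma env_one_neq0 : env_one != 0.
Proof.
have -> : 0 = \pi_U 0 by rewrite -[0 in RHS](subrr 0) env_piB subrr.
apply/eqP => /env_pi_eq; rewrite subr0 => I1.
have f_lin : linear ((fun=> 0) : L -> K^o).
  by move=> a x y; rewrite scaler0 addr0.
have f_lie (x y : L) : 0 = 0 * 0 - 0 * 0 :> K^o by rewrite mulr0 subrr.
have := free_lift_ideal f_lin f_lie I1.
by rewrite free_lift1 => /eqP; rewrite oner_eq0.
Qed.

HB.instance Definition _ := GRing.Zmodule_isNzRing.Build env_alg
  env_mulA env_mul1 env_mulr1 env_mulDl env_mulDr env_one_neq0.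

Lemma env_scaleA a b x : env_scale a (env_scale b x) = env_scale (a * b) x.
Proof. by elim/env_pi_ind: x => x; rewrite -!env_piZ scalerA. Qed.

Lemma env_scale1 : left_id 1 env_scale.
Proof. by elim/env_pi_ind=> x; rewrite -env_piZ scale1r. Qed.

Lemma env_scaleDr : right_distributive env_scale +%R.
Proof.
by move=> a; elim/env_pi_ind=> x; elim/env_pi_ind=> y;
  rewrite -env_piD -!env_piZ -env_piD scalerDr.
Qed.

Lemma env_scaleDl x : {morph env_scale^~ x : a b / a + b}.
Proof.
by elim/env_pi_ind: x => x a b; rewrite -!env_piZ -env_piD scalerDl.
Qed.

HB.instance Definition _ := GRing.Zmodule_isLmodule.Build K env_alg
  env_scaleA env_scale1 env_scaleDr env_scaleDl.

Lemma env_scaleAl (a : K) (x y : U) : a *: (x * y) = a *: x * y.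
Proof.
elim/env_pi_ind: x => x; elim/env_pi_ind: y => y.
change (env_scale a (env_mul (\pi_U x) (\pi_U y))
        = env_mul (env_scale a (\pi_U x)) (\pi_U y)).
by rewrite -env_piM -!env_piZ -env_piM -scalerAl.
Qed.

HB.instance Definition _ := GRing.Lmodule_isLalgebra.Build K env_alg env_scaleAl.

Lemma env_scaleAr (a : K) (x y : U) : a *: (x * y) = x * (a *: y).
Proof.
elim/env_pi_ind: x => x; elim/env_pi_ind: y => y.
change (env_scale a (env_mul (\pi_U x) (\pi_U y))
        = env_mul (\pi_U x) (env_scale a (\pi_U y))).
by rewrite -env_piM -!env_piZ -env_piM malgZAr.
Qed.

HB.instance Definition _ := GRing.Lalgebra_isAlgebra.Build K env_alg env_scaleAr.

Lemma env_pi_mul u v : \pi_U (u * v) = \pi_U u * \pi_U v.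
Proof. exact: env_piM. Qed.

Definition env_inj (x : L) : U := \pi_U (env_gen x).

Lemma env_inj_linear : linear env_inj.
Proof.
move=> a x y; transitivity (\pi_U (a *: env_gen x + env_gen y)).
  by apply/env_pi_eq/env_relatorW/env_relator_linear.
by rewrite env_piD env_piZ.
Qed.

HB.instance Definition _ := GRing.isLinear.Build K L U *:%R env_inj
  env_inj_linear.

Lemma env_inj_lie x y :
  env_inj (lie x y) = env_inj x * env_inj y - env_inj y * env_inj x.
Proof.
transitivity (\pi_U (env_gen x * env_gen y - env_gen y * env_gen x)).
  by apply/env_pi_eq/env_relatorW/env_relator_lie.
exact: etrans (env_piB _ _) (f_equal2 (fun a b => a - b)
  (env_pi_mul _ _) (env_pi_mul _ _)).
Qed.

Lemma env_pi_word (s : seq L) :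
  \pi_U << FMonom s >> = \prod_(x <- s) env_inj x.
Proof.
elim: s => [|x s IHs]; first by rewrite big_nil -fmoneE.
rewrite big_cons -IHs.
have -> : << FMonom (x :: s) >> = env_gen x * << FMonom s >> :> F.
  by rewrite malgM_def fgmulUU mulr1; congr << _ >>; apply/val_inj; rewrite /= fmM fmU.
exact: env_piM.
Qed.

Lemma env_pi_sum (u : F) :
  \pi_U u = \sum_(m <- msupp u) u@_m *: \prod_(x <- (m : seq L)) env_inj x.
Proof.
rewrite {1}[u]monalgE (big_morph _ env_piD (id1 := 0)); last first.
  by rewrite -[0 in LHS](subrr 0) env_piB subrr.
apply: eq_bigr => m _; rewrite -env_pi_word fmK.
transitivity (\pi_U (u@_m *: << m >>)); last exact: env_piZ.
congr (\pi_U _); apply/malgP => k.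
by rewrite mcoeffZ !mcoeffU mulr_natr.
Qed.

Lemma env_inj_universal (A : algType K) (f : L -> A) :
    linear f -> (forall x y, f (lie x y) = f x * f y - f y * f x) ->
  exists g : {lrmorphism U -> A}, (forall x, g (env_inj x) = f x) /\
    forall g' : {lrmorphism U -> A}, (forall x, g' (env_inj x) = f x) ->
      g' =1 g.
Proof.
move=> f_lin f_lie; pose g (x : U) : A := free_lift f (repr x).
have gpi u : g (\pi_U u) = free_lift f u.
  apply/eqP; rewrite -subr_eq0 -free_liftB.
  by rewrite (free_lift_ideal f_lin f_lie) ?env_reprB.
have gB : zmod_morphism g.
  elim/env_pi_ind=> x; elim/env_pi_ind=> y.
  by rewrite -env_piB !gpi free_liftB.
have gZ : scalable g.
  move=> a; elim/env_pi_ind=> x.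
  change (g (env_scale a (\pi_U x)) = a *: g (\pi_U x)).
  by rewrite -env_piZ !gpi free_liftZ.
have gM : monoid_morphism g.
  split; first by rewrite (gpi 1) free_lift1.
  elim/env_pi_ind=> x; elim/env_pi_ind=> y.
  change (g (env_mul (\pi_U x) (\pi_U y)) = g (\pi_U x) * g (\pi_U y)).
  by rewrite -env_piM !gpi free_liftM.
pose gb := GRing.isZmodMorphism.Build U A g gB.
pose gz := GRing.isScalable.Build K U A *:%R g gZ.
pose gm := GRing.isMonoidMorphism.Build U A g gM.
pose G : {lrmorphism U -> A} := HB.pack g gb gz gm.
exists G; split=> [x|g' g'E x]; first by rewrite /= gpi free_lift_gen.
elim/env_pi_ind: x => u; rewrite [G _]gpi.
rewrite env_pi_sum linear_sum /free_lift mmapE; apply: eq_bigr => m _ /=.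
rewrite linearZ -scalerAl mul1r /word_eval rmorph_prod.
by congr (_ *: _); apply: eq_bigr => x _; exact: g'E.
Qed.

End Enveloping.

Arguments env_inj {K L} x.

Definition schrodinger (K : fieldType) : Type := 'rV[K]_6.

Section Schrodinger.
Variable K : fieldType.

Local Notation s := (schrodinger K).

HB.instance Definition _ := Vector.on s.

Definition sch_e : s := delta_mx 0 (inord 0).
Definition sch_h : s := delta_mx 0 (inord 1).
Definition sch_f : s := delta_mx 0 (inord 2).
Definition sch_p : s := delta_mx 0 (inord 3).
Definition sch_q : s := delta_mx 0 (inord 4).
Definition sch_z : s := delta_mx 0 (inord 5).

(* The nonzero brackets of basis vectors (in the order e, h, f, p, q, z), each
   listed once; sch_lie is their bilinear antisymmetric extension. *)
Definition sch_table (i j : 'I_6) : s :=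
  match val i, val j with
  | 1%N, 0%N => 2 *: sch_e
  | 0%N, 2%N => sch_h
  | 1%N, 2%N => - 2 *: sch_f
  | 0%N, 4%N => sch_p
  | 1%N, 3%N => sch_p
  | 2%N, 3%N => sch_q
  | 1%N, 4%N => - sch_q
  | 3%N, 4%N => sch_z
  | _, _ => 0
  end.

Definition sch_lie (x y : s) : s :=
  \sum_(i < 6) \sum_(j < 6) (x 0 i * y 0 j - y 0 i * x 0 j) *: sch_table i j.

Lemma sch_lie_linearl (a : K) x1 x2 y :
  sch_lie (a *: x1 + x2) y = a *: sch_lie x1 y + sch_lie x2 y.
Proof.
rewrite scaler_sumr -big_split; apply: eq_bigr => i _ /=.
rewrite scaler_sumr -big_split; apply: eq_bigr => j _ /=.
by rewrite scalerA -scalerDl !mxE; congr (_ *: _); ring.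
Qed.

Lemma sch_lie_anti x y : sch_lie x y = - sch_lie y x.
Proof.
rewrite -sumrN; apply: eq_bigr => i _ /=; rewrite -sumrN.
by apply: eq_bigr => j _ /=; rewrite -scaleNr opprB.
Qed.

Lemma sch_lie_linearr (a : K) x y1 y2 :
  sch_lie x (a *: y1 + y2) = a *: sch_lie x y1 + sch_lie x y2.
Proof.
by rewrite sch_lie_anti sch_lie_linearl opprD -scalerN -!(sch_lie_anti x).
Qed.

Lemma sch_lie_alternating x : sch_lie x x = 0.
Proof.
by apply: big1 => i _; apply: big1 => j _; rewrite subrr scale0r.
Qed.

Lemma sum_ord6 (V : nmodType) (F : 'I_6 -> V) :
  \sum_(i < 6) F i = F (inord 0) + F (inord 1) + F (inord 2)
                   + F (inord 3) + F (inord 4) + F (inord 5).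
Proof.
rewrite !big_ord_recl big_ord0 addr0 -!addrA.
do 5![congr (F _ + _); first by apply/val_inj; rewrite /= inordK].
by congr (F _); apply/val_inj; rewrite /= inordK.
Qed.

Lemma ord6_ind (P : 'I_6 -> Prop) : P (inord 0) -> P (inord 1) ->
  P (inord 2) -> P (inord 3) -> P (inord 4) -> P (inord 5) -> forall i, P i.
Proof.
move=> P0 P1 P2 P3 P4 P5 i; rewrite -(inord_val i).
by case: i => [[|[|[|[|[|[|//]]]]]]].
Qed.

Lemma inord6_eq (i j : nat) : (i < 6)%N -> (j < 6)%N ->
  (inord i == inord j :> 'I_6) = (i == j).
Proof. by move=> i6 j6; rewrite -val_eqE /= !inordK. Qed.

Lemma sch_lieE (x y : s) :
  let m (i j : nat) := x 0 (inord i) * y 0 (inord j)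
                       - y 0 (inord i) * x 0 (inord j) in
  sch_lie x y = (2 * m 1 0) *: sch_e + m 0 2 *: sch_h - (2 * m 1 2) *: sch_f
    + (m 0 4 + m 1 3) *: sch_p + (m 2 3 - m 1 4) *: sch_q + m 3 4 *: sch_z.
Proof.
move=> m; rewrite /sch_lie sum_ord6 !sum_ord6 /sch_table /= !inordK //.
rewrite !scaler0 !addr0 !add0r.
by apply/rowP; elim/ord6_ind; rewrite !mxE /= !inord6_eq //= /m; ring.
Qed.

Lemma sch_lie_coord (x y : s) :
  let m (i j : nat) := x 0 (inord i) * y 0 (inord j)
                       - y 0 (inord i) * x 0 (inord j) in
  (sch_lie x y 0 (inord 0) = 2 * m 1 0) *
  (sch_lie x y 0 (inord 1) = m 0 2) *
  (sch_lie x y 0 (inord 2) = - (2 * m 1 2)) *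
  (sch_lie x y 0 (inord 3) = m 0 4 + m 1 3) *
  (sch_lie x y 0 (inord 4) = m 2 3 - m 1 4) *
  (sch_lie x y 0 (inord 5) = m 3 4).
Proof.
move=> m; rewrite sch_lieE -!/(m _ _); move: m => m.
by do !split; rewrite !mxE /= !inord6_eq //=; ring.
Qed.

Lemma sch_lie_jacobi x y t :
  sch_lie x (sch_lie y t) + sch_lie y (sch_lie t x)
    + sch_lie t (sch_lie x y) = 0.
Proof.
apply/rowP => i; rewrite [LHS]mxE [X in X + _]mxE [RHS]mxE.
by move: i; apply: ord6_ind; rewrite !sch_lie_coord /=; ring.
Qed.

HB.instance Definition _ := Lmodule_isLieAlgebra.Build K s
  sch_lie_linearl sch_lie_linearr sch_lie_alternating sch_lie_jacobi.

Lemma sch_brackets :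
  [/\ [/\ lie sch_h sch_e = 2 *: sch_e, lie sch_e sch_f = sch_h,
          lie sch_h sch_f = - 2 *: sch_f & lie sch_p sch_q = sch_z],
      [/\ lie sch_e sch_q = sch_p, lie sch_e sch_p = 0 & lie sch_h sch_p = sch_p],
      [/\ lie sch_f sch_p = sch_q, lie sch_f sch_q = 0 & lie sch_h sch_q = - sch_q]
    & forall x, lie sch_z x = 0].
Proof.
do ![split] => [||||||||||x]; rewrite /lie /= sch_lieE !mxE /= !inord6_eq //=;
  apply/rowP => i; rewrite !mxE; ring.
Qed.

Definition sch_c : env_alg s :=
  let e := env_inj sch_e in let h := env_inj sch_h in let f := env_inj sch_f in
  let p := env_inj sch_p in let q := env_inj sch_q in let z := env_inj sch_z in
  (h ^+ 2 + h + 4 * f * e) * z - 2 * (f * p ^+ 2 - e * q ^+ 2 - h * p * q).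

End Schrodinger.

Local Open Scope classical_set_scope.

Definition alg_center (K : fieldType) (A : algType K) : set A :=
  [set x | forall y : A, x * y = y * x].

Definition gen_subalg (K : fieldType) (A : algType K) (S : set A) : set A :=
  smallest (fun B : set A => GRing.subalg_closed (mem B)) S.

Arguments alg_center {K} A.
Arguments gen_subalg {K A} S.

(* Main.v *)
(* The element c is central by a direct computation in normal order.
   Conversely, in the ordered basis f^a q^b z^d h^i p^k e^l the left
   multiplication of U(s) on itself is given by explicit formulas; these satisfy
   the defining relations, so x |-> x . 1 recovers the coefficients of x, as
   polynomials in h.  For a central x, comparing left and right multiplication by
   h, p and e gives recurrences for these coefficients.
   (i) If the coefficients with a = b = k = l = 0 vanish, then x = 0.
   (ii) The coefficients g_l of f^l e^l (for a fixed power of z) satisfy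
   g_l(y) - g_l(y - 2) = (l + 1) (y - l + 1/2) g_{l+1}(y).  As g_l = 0 for large
   l, descending induction gives g_l(y) = g_l(2l - 3 - y), so that g_0 is a
   polynomial in (y + 1)(y + 2).  Since c projects to (y + 1)(y + 2) z, some
   z^M x lies in C[z, c] by (i).
   (iii) If z x = g(c) + z u then g = 0: evaluate in a module on which z acts by
   0 and c by arbitrary scalars.  Hence the powers of z can be cancelled. *)

Require Import Defs.
From Stdlib Require Import Ncring Ncring_tac.
From HB Require Import structures.
From mathcomp Require Import all_boot all_order all_algebra.
From mathcomp Require Import boolp classical_sets functions reals complex.
From mathcomp Require Import finmap monalg.
From mathcomp Require Import zify ring.

Set Implicit Arguments.
Unset Strict Implicit.
Unset Printing Implicit Defensive.

Import Order.TTheory GRing.Theory Num.Theory.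

Local Open Scope ring_scope.

(** * Operators and representations *)

Section Operators.
Variables (K : fieldType) (V : lmodType K) (v : V) (v_neq0 : v != 0).

(* The nonzero vector v is recorded in the type so that the ring of operators
   is canonically nontrivial. *)
Record endo (nz : v != 0) := Operator {
  op_fun :> V -> V;
  op_comb : forall c F G, op_fun (c *: F + G) = c *: op_fun F + op_fun G }.

Local Notation operator := (endo v_neq0).

HB.instance Definition _ := gen_eqMixin operator.
HB.instance Definition _ := gen_choiceMixin operator.

Lemma operatorP (S T : operator) : (forall F, S F = T F) -> S = T.
Proof.
case: S T => [S linS] [T linT] /= /funext eqST.
by move: linS; rewrite eqST => linS; congr Operator; apply: Prop_irrelevance.
Qed.

Fact op0_comb (c : K) (F G : V) : 0 = c *: 0 + 0 :> V.
Proof. by rewrite scaler0 addr0. Qed.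

Fact opN_comb (S : operator) c F G : - S (c *: F + G) = c *: - S F + - S G.
Proof. by rewrite op_comb opprD scalerN. Qed.

Fact opD_comb (S T : operator) c F G :
  S (c *: F + G) + T (c *: F + G) = c *: (S F + T F) + (S G + T G).
Proof. by rewrite !op_comb scalerDr addrACA. Qed.

Fact opM_comb (S T : operator) c F G :
  S (T (c *: F + G)) = c *: S (T F) + S (T G).
Proof. by rewrite !op_comb. Qed.

Fact opZ_comb (a : K) (S : operator) c F G :
  a *: S (c *: F + G) = c *: (a *: S F) + a *: S G.
Proof. by rewrite op_comb scalerDr !scalerA mulrC. Qed.

Definition op0 : operator := Operator _ op0_comb.
Definition opN S : operator := Operator _ (opN_comb S).
Definition opD S T : operator := Operator _ (opD_comb S T).
Definition op1 : operator := @Operator _ id (fun _ _ _ => erefl).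
Definition opM S T : operator := Operator _ (opM_comb S T).
Definition opZ c S : operator := Operator _ (opZ_comb c S).

Lemma opDA : associative opD.
Proof. by move=> S T W; apply: operatorP => F /=; rewrite addrA. Qed.
Lemma opDC : commutative opD.
Proof. by move=> S T; apply: operatorP => F /=; rewrite addrC. Qed.
Lemma op0D : left_id op0 opD.
Proof. by move=> S; apply: operatorP => F /=; rewrite add0r. Qed.
Lemma opND : left_inverse op0 opN opD.
Proof. by move=> S; apply: operatorP => F /=; rewrite addNr. Qed.

HB.instance Definition _ := GRing.isZmodule.Build operator opDA opDC op0D opND.

Lemma op_is_additive (S : operator) (F G : V) : S (F + G) = S F + S G.
Proof. by have := op_comb S 1 F G; rewrite !scale1r. Qed.

Lemma op_is_scalable (S : operator) (c : K) (F : V) :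
  S (c *: F) = c *: S F.
Proof.
have S0 : S 0 = 0 by apply: (addrI (S 0)); rewrite -op_is_additive !addr0.
by have := op_comb S c F 0; rewrite S0 !addr0.
Qed.

Lemma opMA : associative opM.
Proof. by move=> S T W; apply: operatorP. Qed.
Lemma op1M : left_id op1 opM.
Proof. by move=> S; apply: operatorP. Qed.
Lemma opM1 : right_id op1 opM.
Proof. by move=> S; apply: operatorP. Qed.
Lemma opMDl : left_distributive opM +%R.
Proof. by move=> S T W; apply: operatorP. Qed.
Lemma opMDr : right_distributive opM +%R.
Proof. by move=> S T W; apply: operatorP => F /=; rewrite op_is_additive. Qed.
Lemma op1_neq0 : op1 != 0.
Proof.
apply/eqP => /(congr1 (fun S : operator => S v)) /eqP.
by rewrite (negPf v_neq0).
Qed.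

HB.instance Definition _ := GRing.Zmodule_isNzRing.Build operator
  opMA op1M opM1 opMDl opMDr op1_neq0.

Lemma opZA c c' S : opZ c (opZ c' S) = opZ (c * c') S.
Proof. by apply: operatorP => F /=; rewrite scalerA. Qed.
Lemma op1Z : left_id 1 opZ.
Proof. by move=> S; apply: operatorP => F /=; rewrite scale1r. Qed.
Lemma opZDr : right_distributive opZ +%R.
Proof. by move=> c S T; apply: operatorP => F /=; rewrite scalerDr. Qed.
Lemma opZDl S : {morph opZ^~ S : c c' / c + c'}.
Proof. by move=> c c'; apply: operatorP => F /=; rewrite scalerDl. Qed.

HB.instance Definition _ := GRing.Zmodule_isLmodule.Build K operator
  opZA op1Z opZDr opZDl.

Lemma opZAl (c : K) (S T : operator) : c *: (S * T) = c *: S * T.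
Proof. by apply: operatorP. Qed.
HB.instance Definition _ := GRing.Lmodule_isLalgebra.Build K operator opZAl.

Lemma opZAr (c : K) (S T : operator) : c *: (S * T) = S * (c *: T).
Proof. by apply: operatorP => F /=; rewrite -op_is_scalable. Qed.
HB.instance Definition _ := GRing.Lalgebra_isAlgebra.Build K operator opZAr.

Lemma opE : ((forall (S T : operator) F, ((S + T) F = S F + T F)%R)
  * (forall (S : operator) F, ((- S) F = - S F)%R)
  * (forall (S T : operator) F, ((S * T) F = S (T F))%R)
  * (forall F, ((1 : operator) F = F)%R)
  * (forall F, ((0 : operator) F = 0)%R)
  * (forall (c : K) (S : operator) F, ((c *: S) F = c *: S F)%R))%type.
Proof. by []. Qed.

End Operators.

(** * Algebra morphisms out of the enveloping algebra, from six elements satisfying the relations *)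

Section Representation.
Variables (K : fieldType) (A : algType K) (X : 'I_6 -> A).

Definition sch_ext (x : schrodinger K) : A := \sum_i x 0 i *: X i.

Lemma sch_ext_linear : linear sch_ext.
Proof.
move=> c x y; rewrite /sch_ext scaler_sumr -big_split; apply: eq_bigr => i _.
by rewrite !mxE scalerDl scalerA.
Qed.

HB.instance Definition _ :=
  GRing.isLinear.Build K (schrodinger K) A *:%R sch_ext sch_ext_linear.

Hypothesis X_comm : forall i j, X i * X j - X j * X i
  = sch_ext (sch_table K i j) - sch_ext (sch_table K j i).

(** [sch_table] lists each bracket only once. Exchanging the two indices in the half of [lie x y]
    that carries the minus sign produces the antisymmetrised table of [X_comm]; bilinearity does the
    rest. *)
Lemma sch_ext_lie (x y : schrodinger K) :
  sch_ext (lie x y) = sch_ext x * sch_ext y - sch_ext y * sch_ext x.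
Proof.
pose B i j := sch_ext (sch_table K i j).
have -> : sch_ext x * sch_ext y - sch_ext y * sch_ext x
    = \sum_i \sum_j (x 0 i * y 0 j) *: (B i j - B j i).
  rewrite {1 4}/sch_ext mulr_suml mulr_sumr -sumrB; apply: eq_bigr => i _.
  rewrite {1 2}/sch_ext mulr_suml mulr_sumr -sumrB; apply: eq_bigr => j _.
  rewrite -X_comm scalerBr -!scalerAl -!scalerAr !scalerA.
  by congr (_ - _); rewrite mulrC.
transitivity (\sum_i \sum_j (x 0 i * y 0 j) *: B i j
              - \sum_i \sum_j (x 0 j * y 0 i) *: B i j).
  rewrite linear_sum -sumrB; apply: eq_bigr => i _.
  rewrite linear_sum -sumrB; apply: eq_bigr => j _.
  by rewrite linearZ /= -scalerBl [y 0 i * _]mulrC.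
rewrite [X in _ - X]exchange_big -sumrB; apply: eq_bigr => i _ /=.
by rewrite -sumrB; apply: eq_bigr => j _; rewrite scalerBr.
Qed.

End Representation.

(** One equation for each of the fifteen pairs of generators, in an arbitrary algebra, so that it
    applies to the enveloping algebra and to operators alike. *)
Definition sch_relations (K : fieldType) (A : algType K) (E H F P Q Z : A) :=
  [/\ [/\ H * E = E * H + 2 *: E, E * F = F * E + H, H * F = F * H - 2 *: F
        , P * Q = Q * P + Z & E * Q = Q * E + P],
      [/\ E * P = P * E, H * P = P * H + P, F * P = P * F + Q, F * Q = Q * F
        & H * Q = Q * H - Q]
    & [/\ Z * E = E * Z, Z * H = H * Z, Z * F = F * Z, Z * P = P * Z
        & Z * Q = Q * Z]].

Section SchrodingerRelations.
Variables (K : fieldType) (A : algType K) (E H F P Q Z : A).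

Hypothesis rel : sch_relations E H F P Q Z.

Let HE : H * E = E * H + 2 *: E. Proof. by case: rel => [[]]. Qed.
Let EF : E * F = F * E + H. Proof. by case: rel => [[]]. Qed.
Let HF : H * F = F * H - 2 *: F. Proof. by case: rel => [[]]. Qed.
Let PQ : P * Q = Q * P + Z. Proof. by case: rel => [[]]. Qed.
Let EQ : E * Q = Q * E + P. Proof. by case: rel => [[]]. Qed.
Let EP : E * P = P * E. Proof. by case: rel => [_ []]. Qed.
Let HP : H * P = P * H + P. Proof. by case: rel => [_ []]. Qed.
Let FP : F * P = P * F + Q. Proof. by case: rel => [_ []]. Qed.
Let FQ : F * Q = Q * F. Proof. by case: rel => [_ []]. Qed.
Let HQ : H * Q = Q * H - Q. Proof. by case: rel => [_ []]. Qed.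
Let ZE : Z * E = E * Z. Proof. by case: rel => [_ _ []]. Qed.
Let ZH : Z * H = H * Z. Proof. by case: rel => [_ _ []]. Qed.
Let ZF : Z * F = F * Z. Proof. by case: rel => [_ _ []]. Qed.
Let ZP : Z * P = P * Z. Proof. by case: rel => [_ _ []]. Qed.
Let ZQ : Z * Q = Q * Z. Proof. by case: rel => [_ _ []]. Qed.

Lemma sch_rep_exists : exists g : {lrmorphism env_alg (schrodinger K) -> A},
  [/\ g (env_inj (sch_e K)) = E, g (env_inj (sch_h K)) = H,
      g (env_inj (sch_f K)) = F & [/\ g (env_inj (sch_p K)) = P,
      g (env_inj (sch_q K)) = Q & g (env_inj (sch_z K)) = Z]].
Proof.
pose X (i : 'I_6) := [:: E; H; F; P; Q; Z]`_i.
have Xd i : sch_ext X (delta_mx 0 i) = X i.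
  rewrite /sch_ext (bigD1 i) //= mxE !eqxx scale1r big1 ?addr0 // => j ji.
  by rewrite mxE /= (negPf ji) scale0r.
have X_comm i j : X i * X j - X j * X i
    = sch_ext X (sch_table K i j) - sch_ext X (sch_table K j i).
{ move: i j; apply: ord6_ind; apply: ord6_ind;
    rewrite /sch_table /= ?inordK //= ?linearZ ?linearN ?linear0 /= ?Xd;
    rewrite /X ?inordK //= ?subrr ?subr0 ?sub0r ?opprK //.
  all: rewrite ?HE ?EF ?HF ?PQ ?EQ ?EP ?HP ?FP ?FQ ?HQ ?ZE ?ZH ?ZF ?ZP ?ZQ.
  all: rewrite ?subrr ?scaleNr ?opprK //.
  all: rewrite ?scalerN ?opprB ?opprD ?opprK ?addr0 ?add0r ?addrA ?subrr ?addNr.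
  all: rewrite ?add0r //.
  all: by rewrite addrAC subrr add0r. }
have [g [gX _]] :=
  env_inj_universal (@sch_ext_linear _ _ X) (sch_ext_lie X_comm).
exists g; split; [..|split]; by rewrite gX [LHS]Xd /X inordK.
Qed.

End SchrodingerRelations.

(** * The Casimir element *)

Section CasimirCentral.
Variables (K : fieldType) (A : algType K) (E H F P Q Z : A).

(** The expression of [sch_c] in six elements of any algebra; it is evaluated in [env_alg] and in
    both operator representations. *)
Definition casimir : A :=
  (H ^+ 2 + H + 4 * F * E) * Z - 2 * (F * P ^+ 2 - E * Q ^+ 2 - H * P * Q).

Hypothesis rel : sch_relations E H F P Q Z.

(** Doubles are written as sums, here and in [casimirE], because the structure handed to
    [non_commutative_ring] has ring operations but no scalars. *)
Let HE : H * E = E * H + (E + E).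
Proof. by case: rel => [[-> _ _ _ _] _ _]; rewrite scaler_nat mulr2n. Qed.
Let EF : E * F = F * E + H. Proof. by case: rel => [[]]. Qed.
Let HF : H * F = F * H - (F + F).
Proof. by case: rel => [[_ _ -> _ _] _ _]; rewrite scaler_nat mulr2n. Qed.
Let PQ : P * Q = Q * P + Z. Proof. by case: rel => [[]]. Qed.
Let EQ : E * Q = Q * E + P. Proof. by case: rel => [[]]. Qed.
Let EP : E * P = P * E. Proof. by case: rel => [_ []]. Qed.
Let HP : H * P = P * H + P. Proof. by case: rel => [_ []]. Qed.
Let FP : F * P = P * F + Q. Proof. by case: rel => [_ []]. Qed.
Let FQ : F * Q = Q * F. Proof. by case: rel => [_ []]. Qed.
Let HQ : H * Q = Q * H - Q. Proof. by case: rel => [_ []]. Qed.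
Let ZE : Z * E = E * Z. Proof. by case: rel => [_ _ []]. Qed.
Let ZH : Z * H = H * Z. Proof. by case: rel => [_ _ []]. Qed.
Let ZF : Z * F = F * Z. Proof. by case: rel => [_ _ []]. Qed.
Let ZP : Z * P = P * Z. Proof. by case: rel => [_ _ []]. Qed.
Let ZQ : Z * Q = Q * Z. Proof. by case: rel => [_ _ []]. Qed.

#[local] Instance opsA :
  @Ring_ops A 0 1 +%R *%R (fun x y => x - y) -%R eq := {}.
#[local] Instance ringA : Ring (Ro := opsA).
Proof.
split; rewrite /addition /multiplication /subtraction /opposite /equality
  /zero /one /=.
all: try by [exact: eq_equivalence | move=> ? ? -> ? ? -> | move=> ? ? ->].
- exact (@add0r A).
- exact (@addrC A).
- exact (@addrA A).
- exact (@mul1r A).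
- exact (@mulr1 A).
- exact (@mulrA A).
- exact (@mulrDl A).
- exact (fun x y z => @mulrDr A z x y).
- by [].
- exact (@subrr A).
Qed.

Let EH : E * H = H * E - (E + E).
Proof. by rewrite HE addrK. Qed.
Let PH : P * H = H * P - P.
Proof. by rewrite HP addrK. Qed.
Let PF : P * F = F * P - Q.
Proof. by rewrite FP addrK. Qed.

(** Gives each commutation rule a second form, for a pair of letters followed by the rest of a
    right-associated word. *)
Let swap (X Y W : A) : X * Y = W -> forall T, X * (Y * T) = W * T.
Proof. by move=> <- T; rewrite mulrA. Qed.

(* Rewriting to the normal order f < q < h < z < p < e. *)
Let rules := (EH, HF, PH, PF, EF, PQ, EQ, EP, HQ, esym FQ, ZE, ZH, ZF, ZP, ZQ).
Let ruleT := (swap EH, swap HF, swap PH, swap PF, swap EF, swap PQ, swap EQ,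
  swap EP, swap HQ, swap (esym FQ), swap ZE, swap ZH, swap ZF, swap ZP,
  swap ZQ).

Lemma casimirE : casimir =
  (H * H + H + (F * E + F * E + F * E + F * E)) * Z
  - (F * P * P - E * Q * Q - H * P * Q + (F * P * P - E * Q * Q - H * P * Q)).
Proof.
rewrite /casimir !expr2 !mulr_natl !mulrS !mulr0n !addr0.
by rewrite !mulrDl -!mulrA !addrA.
Qed.

Ltac normalize := rewrite casimirE;
  repeat progress
    rewrite ?(mulrDl, mulrDr, mulrN, mulNr) -?mulrA ?(rules, ruleT);
  non_commutative_ring.

Lemma casimirCE : E * casimir = casimir * E.
Proof. normalize. Qed.
Lemma casimirCF : F * casimir = casimir * F.
Proof. normalize. Qed.
Lemma casimirCP : P * casimir = casimir * P.
Proof. normalize. Qed.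

(** Since h = [e, f], q = [f, p] and z = [p, q], the elements e, f, p generate everything; hence
    only three commutations are computed for [casimir]. *)
Lemma comm_generators c : GRing.comm c E -> GRing.comm c F -> GRing.comm c P ->
  forall g, g \in [:: E; H; F; P; Q; Z] -> GRing.comm c g.
Proof.
move=> cE cF cP.
have cH : GRing.comm c H.
  have -> : H = E * F - F * E by rewrite EF addrC addKr.
  by apply: commrB; apply: commrM.
have cQ : GRing.comm c Q.
  have -> : Q = F * P - P * F by rewrite FP addrC addKr.
  by apply: commrB; apply: commrM.
have cZ : GRing.comm c Z.
  have -> : Z = P * Q - Q * P by rewrite PQ addrC addKr.
  by apply: commrB; apply: commrM.
move=> g; rewrite !inE.
by move=> /or4P[/eqP->|/eqP->|/eqP->|/or3P[/eqP->|/eqP->|/eqP->]].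
Qed.

End CasimirCentral.

Lemma comm_comb (K : pzRingType) (A : algType K) (c : K) (x y u : A) :
  GRing.comm u x -> GRing.comm u y -> GRing.comm u (c *: x + y).
Proof.
move=> ux uy; apply: commrD => //.
by rewrite /GRing.comm -scalerAr ux -scalerAl.
Qed.

(** * Poincare-Birkhoff-Witt spanning *)

Section Span.
Variables (K : fieldType) (A : algType K).

(** Only sums are built in: the generating sets used below absorb scalars into their polynomial
    factor in [H]. *)
Inductive span (M : A -> Prop) : A -> Prop :=
| span0 : span M 0
| spanD x y : M x -> span M y -> span M (x + y).

Lemma span_gen M x : M x -> span M x.
Proof. by move=> Mx; rewrite -[x]addr0; apply: spanD => //; apply: span0. Qed.

Lemma span_add M x y : span M x -> span M y -> span M (x + y).
Proof.
move=> + sy; elim=> [|u v Mu _ IH]; rewrite ?add0r // -addrA.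
exact: spanD.
Qed.

Lemma span_mull M N X : (forall x, M x -> span N (X * x)) ->
  forall x, span M x -> span N (X * x).
Proof.
move=> MN x; elim=> [|u v Mu _ IH]; first by rewrite mulr0; apply: span0.
by rewrite mulrDr; apply: span_add => //; apply: MN.
Qed.

Lemma span_scale M c : (forall x, M x -> M (c *: x)) ->
  forall x, span M x -> span M (c *: x).
Proof.
move=> MM x; elim=> [|u v Mu _ IH]; first by rewrite scaler0; apply: span0.
by rewrite scalerDr; apply: span_add => //; apply/span_gen/MM.
Qed.

End Span.

Section PBWSpan.
Variables (K : fieldType) (A : algType K) (E H F P Q Z : A).

(** All powers of [H] are gathered in one polynomial, so that moving a generator past them is a
    shift of the argument. The parentheses follow the layers [M1], [M2], [M3] below. *)
Definition pbw_mon (i : nat * nat * nat * nat * nat) (g : {poly K}) : A :=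
  let: (a, b, d, k, l) := i in
  F ^+ a * (Q ^+ b * (Z ^+ d * horner_alg H g * P ^+ k * E ^+ l)).

Hypothesis rel : sch_relations E H F P Q Z.

Let HE : H * E = E * H + 2 *: E. Proof. by case: rel => [[]]. Qed.
Let EF : E * F = F * E + H. Proof. by case: rel => [[]]. Qed.
Let HF : H * F = F * H - 2 *: F. Proof. by case: rel => [[]]. Qed.
Let PQ : P * Q = Q * P + Z. Proof. by case: rel => [[]]. Qed.
Let EQ : E * Q = Q * E + P. Proof. by case: rel => [[]]. Qed.
Let EP : E * P = P * E. Proof. by case: rel => [_ []]. Qed.
Let HP : H * P = P * H + P. Proof. by case: rel => [_ []]. Qed.
Let FP : F * P = P * F + Q. Proof. by case: rel => [_ []]. Qed.
Let FQ : F * Q = Q * F. Proof. by case: rel => [_ []]. Qed.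
Let HQ : H * Q = Q * H - Q. Proof. by case: rel => [_ []]. Qed.
Let ZE : Z * E = E * Z. Proof. by case: rel => [_ _ []]. Qed.
Let ZH : Z * H = H * Z. Proof. by case: rel => [_ _ []]. Qed.
Let ZF : Z * F = F * Z. Proof. by case: rel => [_ _ []]. Qed.
Let ZP : Z * P = P * Z. Proof. by case: rel => [_ _ []]. Qed.
Let ZQ : Z * Q = Q * Z. Proof. by case: rel => [_ _ []]. Qed.

Lemma horner_alg_shift X (c : K) : X * H = (H - c%:A) * X -> forall g,
  X * horner_alg H g = horner_alg H (g \Po ('X - c%:P)) * X.
Proof.
move=> XH; elim/poly_ind => [|g b IH].
  by rewrite comp_poly0 !rmorph0 mulr0 mul0r.
rewrite comp_polyD comp_polyM comp_polyX comp_polyC !rmorphD !rmorphM /=.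
rewrite rmorphB /= !horner_algX !horner_algC mulrDr mulrA IH -!mulrA.
rewrite -[in LHS]scalerAr mulr1 mulrDl -[in RHS]scalerAl mul1r -!mulrA XH.
by rewrite !mulrA.
Qed.

(** Normal words are built in three layers. Left multiplication by [Z], [H], [P], [E] sends a word
    of [M1] to a single word of [M1]; moving these letters past a leading [Q] or [F] adds commutator
    terms, which stay in the span of [M2] or [M3]. Induction on the exponent of [Q], then of [F],
    therefore suffices. *)
Let M1 x := exists d k l g, x = Z ^+ d * horner_alg H g * P ^+ k * E ^+ l.
Let M2 x := exists b m, M1 m /\ x = Q ^+ b * m.
Let M3 x := exists a m, M2 m /\ x = F ^+ a * m.

Let ZC d X : Z * X = X * Z -> X * Z ^+ d = Z ^+ d * X.
Proof. by move=> ZX; apply: commrX; rewrite /GRing.comm ZX. Qed.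

Let M1Z x : M1 x -> M1 (Z * x).
Proof.
by move=> [d [k [l [g ->]]]]; exists d.+1, k, l, g; rewrite exprS !mulrA.
Qed.
Let M1H x : M1 x -> M1 (H * x).
Proof.
move=> [d [k [l [g ->]]]]; exists d, k, l, ('X * g).
by rewrite rmorphM /= horner_algX !mulrA ZC.
Qed.
Let M1P x : M1 x -> M1 (P * x).
Proof.
move=> [d [k [l [g ->]]]]; exists d, k.+1, l, (g \Po ('X - 1%:P)).
rewrite !mulrA ZC // -!mulrA [P * (horner_alg _ _ * _)]mulrA.
rewrite (@horner_alg_shift _ 1) ?exprS ?mulrA //.
by rewrite scale1r mulrBl mul1r HP addrK.
Qed.
Let M1E x : M1 x -> M1 (E * x).
Proof.
move=> [d [k [l [g ->]]]]; exists d, k, l.+1, (g \Po ('X - 2%:P)).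
rewrite !mulrA ZC // -!mulrA [E * (horner_alg _ _ * _)]mulrA.
rewrite (@horner_alg_shift _ 2); last first.
  by rewrite mulrBl HE -scalerAl mul1r addrK.
have CEP : GRing.comm E (P ^+ k) by apply: commrX.
by rewrite exprS -!mulrA [E * (P ^+ _ * _)]mulrA CEP -!mulrA.
Qed.
Let M1s c x : M1 x -> M1 (c *: x).
Proof.
move=> [d [k [l [g ->]]]]; exists d, k, l, (c *: g).
rewrite -mul_polyC rmorphM /= horner_algC -scalerAl mul1r.
by rewrite -!(scalerAr, scalerAl).
Qed.
Let M2s c x : M2 x -> M2 (c *: x).
Proof.
move=> [b [m [Mm ->]]]; exists b, (c *: m).
by rewrite scalerAr; split => //; apply: M1s.
Qed.
Let M3s c x : M3 x -> M3 (c *: x).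
Proof.
move=> [b [m [Mm ->]]]; exists b, (c *: m).
by rewrite scalerAr; split => //; apply: M2s.
Qed.

Let M12 x : M1 x -> span M2 x.
Proof. by move=> Mx; apply: span_gen; exists 0%N, x; rewrite mul1r. Qed.
Let M23 x : M2 x -> span M3 x.
Proof. by move=> Mx; apply: span_gen; exists 0%N, x; rewrite mul1r. Qed.
Let S23 x : span M2 x -> span M3 x.
Proof.
move=> /(span_mull (X := 1)); rewrite mul1r; apply => y; rewrite mul1r.
exact: M23.
Qed.

Let M2Q x : span M2 x -> span M2 (Q * x).
Proof.
apply: span_mull => _ [b [m [Mm ->]]]; apply: span_gen.
by exists b.+1, m; rewrite exprS mulrA.
Qed.
Let M3F x : span M3 x -> span M3 (F * x).
Proof.
apply: span_mull => _ [b [m [Mm ->]]]; apply: span_gen.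
by exists b.+1, m; rewrite exprS mulrA.
Qed.
Let M2N x : span M2 x -> span M2 (- x).
Proof. by rewrite -scaleN1r; apply: span_scale => // y; apply: M2s. Qed.
Let M3N x : span M3 x -> span M3 (- x).
Proof. by rewrite -scaleN1r; apply: span_scale => // y; apply: M3s. Qed.

Let M2ind X : (forall x, M1 x -> M1 (X * x)) ->
    (forall m, M2 m -> span M2 (X * m) -> span M2 (X * (Q * m))) ->
  forall x, span M2 x -> span M2 (X * x).
Proof.
move=> M1X XQ; apply: span_mull => _ [b [m [Mm ->]]].
elim: b => [|b IH]; first by rewrite mul1r; apply/M12/M1X.
by rewrite exprS -mulrA; apply: XQ => //; exists b, m.
Qed.

Let M3ind X : (forall x, span M2 x -> span M2 (X * x)) ->
    (forall m, M3 m -> span M3 (X * m) -> span M3 (X * (F * m))) ->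
  forall x, span M3 x -> span M3 (X * x).
Proof.
move=> M2X XF; apply: span_mull => _ [b [m [Mm ->]]].
elim: b => [|b IH]; first by rewrite mul1r; apply/S23/M2X/span_gen.
by rewrite exprS -mulrA; apply: XF => //; exists b, m.
Qed.

Let M2Z x : span M2 x -> span M2 (Z * x).
Proof. by apply: M2ind => // m Mm Sm; rewrite mulrA ZQ -mulrA; apply: M2Q. Qed.
Let M2H x : span M2 x -> span M2 (H * x).
Proof.
apply: M2ind => // m Mm Sm; rewrite mulrA HQ mulrBl -mulrA.
by apply: span_add; [apply: M2Q | apply/M2N/M2Q/span_gen].
Qed.
Let M2P x : span M2 x -> span M2 (P * x).
Proof.
apply: M2ind => // m Mm Sm; rewrite mulrA PQ mulrDl -mulrA.
by apply: span_add; [apply: M2Q | apply/M2Z/span_gen].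
Qed.
Let M2E x : span M2 x -> span M2 (E * x).
Proof.
apply: M2ind => // m Mm Sm; rewrite mulrA EQ mulrDl -mulrA.
by apply: span_add; [apply: M2Q | apply/M2P/span_gen].
Qed.

Let M3Z x : span M3 x -> span M3 (Z * x).
Proof. by apply: M3ind => // m Mm Sm; rewrite mulrA ZF -mulrA; apply: M3F. Qed.
Let M3Q x : span M3 x -> span M3 (Q * x).
Proof. by apply: M3ind => // m Mm Sm; rewrite mulrA -FQ -mulrA; apply: M3F. Qed.
Let M3H x : span M3 x -> span M3 (H * x).
Proof.
apply: M3ind => // m Mm Sm; rewrite mulrA HF mulrBl -mulrA -scalerAl.
apply: span_add; [exact: M3F | apply: M3N].
by apply: span_scale => [y|]; [apply: M3s | apply/M3F/span_gen].
Qed.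
Let M3P x : span M3 x -> span M3 (P * x).
Proof.
apply: M3ind => // m Mm Sm.
have -> : P * (F * m) = F * (P * m) - Q * m.
  by rewrite [F * (P * _)]mulrA FP mulrDl addrK mulrA.
by apply: span_add; [apply: M3F | apply/M3N/M3Q/span_gen].
Qed.
Let M3E x : span M3 x -> span M3 (E * x).
Proof.
apply: M3ind => // m Mm Sm; rewrite mulrA EF mulrDl -mulrA.
by apply: span_add; [apply: M3F | apply/M3H/span_gen].
Qed.

Definition pbw_span := span (fun x => exists i g, x = pbw_mon i g).

Let M3W x : span M3 x -> pbw_span x.
Proof.
move=> /(span_mull (X := 1)); rewrite mul1r; apply=> y.
move=> [a [_ [[b [_ [[d [k [l [g ->]]]] ->]]] ->]]].
by rewrite mul1r; apply: span_gen; exists (a, b, d, k, l), g.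
Qed.
Let WM3 x : pbw_span x -> span M3 x.
Proof.
move=> /(span_mull (X := 1)); rewrite mul1r; apply=> y.
move=> [[[[[a b] d] k] l] [g ->]].
rewrite mul1r; apply: span_gen; exists a; eexists; split; last by [].
by exists b; eexists; split; last by []; exists d, k, l, g.
Qed.

Lemma pbw_span_mull X : X \in [:: E; H; F; P; Q; Z] ->
  forall x, pbw_span x -> pbw_span (X * x).
Proof.
rewrite !inE => XG x /WM3 Sx; apply: M3W.
by move: XG => /or4P[/eqP->|/eqP->|/eqP->|/or3P[/eqP->|/eqP->|/eqP->]]; auto.
Qed.

Lemma pbw_span_comb c x y : pbw_span x -> pbw_span y -> pbw_span (c *: x + y).
Proof.
move=> Sx Sy; apply: span_add => //; apply: span_scale => // _ [i [g ->]].
exists i, (c *: g); case: i => [[[[a b] d] k] l] /=.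
rewrite -mul_polyC rmorphM /= horner_algC -scalerAl mul1r.
by rewrite -!(scalerAr, scalerAl).
Qed.

Lemma pbw_span1 : pbw_span 1.
Proof.
apply: span_gen; exists (0, 0, 0, 0, 0)%N, 1.
by rewrite /pbw_mon !expr0 rmorph1 !mulr1.
Qed.

Lemma pbw_span_normal x : pbw_span x ->
  exists s (G : _ -> {poly K}), uniq s /\ x = \sum_(i <- s) pbw_mon i (G i).
Proof.
elim=> [|_ y [i [g ->]] _ [s [G [us ->]]]].
  by exists [::], (fun=> 0); rewrite big_nil.
have monD j g1 g2 : pbw_mon j (g1 + g2) = pbw_mon j g1 + pbw_mon j g2.
  case: j => [[[[a b] d] k] l].
  by rewrite /= rmorphD !(mulrDr, mulrDl) /= ?mulrDl ?mulrDr.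
(* Terms with equal exponents are merged, as [pbw_mon] is additive in its polynomial. Outside [s]
   the value of [G] is arbitrary, so it must be replaced by 0. *)
pose G' j := if j == i then g + (if i \in s then G i else 0) else G j.
have eqG t : i \notin t ->
    \sum_(j <- t) pbw_mon j (G' j) = \sum_(j <- t) pbw_mon j (G j).
  move=> it; rewrite big_seq [RHS]big_seq; apply: eq_bigr => j jt.
  by rewrite /G'; case: eqP jt it => // -> ->.
case: (boolP (i \in s)) => [is_|nis].
  exists s, G'; split=> //.
  rewrite (perm_big _ (perm_to_rem is_)) big_cons.
  rewrite [RHS](perm_big _ (perm_to_rem is_)) big_cons eqG ?mem_rem_uniqF //.
  by rewrite [in RHS]/G' eqxx is_ monD addrA.
exists (i :: s), G'; rewrite /= nis us; split=> //.
by rewrite big_cons eqG // /G' eqxx (negPf nis) addr0.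
Qed.

End PBWSpan.

(** * The left regular representation *)

Section Representations.
Variable K : numFieldType.

(* F a b d k l y is the coefficient of f^a q^b z^d h^* p^k e^l, seen as a function
   of the value y of h.  The exponents range over K, so that the formulas below
   need no case distinction at 0. *)
Definition states : Type := K -> K -> K -> K -> K -> K -> K^o.

HB.instance Definition _ := GRing.Lmodule.on states.

Lemma statesP (F G : states) :
  (forall a b d k l y, F a b d k l y = G a b d k l y) -> F = G.
Proof. by move=> eqFG; do 6![apply: funext => ?]. Qed.

Lemma statesE :
  ((forall (c : K) (F : states) a b d k l y,
     ((c *: F) a b d k l y = c * F a b d k l y)%R)
  * (forall (F G : states) a b d k l y,
     ((F + G) a b d k l y = F a b d k l y + G a b d k l y)%R)
  * (forall (F : states) a b d k l y, ((- F) a b d k l y = - F a b d k l y)%R)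
  * (forall a b d k l y, ((0 : states) a b d k l y = 0)%R))%type.
Proof. by []. Qed.

(** The coefficients of the unit 1: the constant polynomial 1 at exponents 0. *)
Definition vacuum : states := fun a b d k l _ =>
  ((a == 0) && (b == 0) && (d == 0) && (k == 0) && (l == 0))%:R.

Lemma vacuum_neq0 : vacuum != 0.
Proof.
apply/eqP => /(congr1 (fun F : states => F 0 0 0 0 0 0)) /eqP.
by rewrite /vacuum !eqxx oner_eq0.
Qed.

Local Notation op := (endo vacuum_neq0).

Definition regf_fun (F : states) : states :=
  fun a b d k l y => F (a - 1) b d k l y.
Definition regq_fun (F : states) : states :=
  fun a b d k l y => F a (b - 1) d k l y.
Definition regz_fun (F : states) : states :=
  fun a b d k l y => F a b (d - 1) k l y.
Definition regh_fun (F : states) : states :=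
  fun a b d k l y => (y - 2 * a - b) * F a b d k l y.
(** Encodes p f^a = f^a p - a f^(a-1) q, p q^b = q^b p + b q^(b-1) z and p g(h) = g(h-1) p, read off
    at the exponents of the result. *)
Definition regp_fun (F : states) : states :=
  fun a b d k l y => F a b d (k - 1) l (y - 1)
    + (b + 1) * F a (b + 1) (d - 1) k l y
    - (a + 1) * F (a + 1) (b - 1) d k l y.
(** Encodes e f^a = f^a e + a f^(a-1) (h-a+1), e q^b = q^b e + b q^(b-1) p + b(b-1)/2 q^(b-2) z and
    e g(h) = g(h-2) e. Shifts by 2 are written as two unit shifts, so that they match the arguments
    obtained by composing operators. *)
Definition rege_fun (F : states) : states :=
  fun a b d k l y => F a b d k (l - 1) (y - 1 - 1)
    + (b + 1) * F a (b + 1) d (k - 1) l (y - 1)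
    + (b + 2) * (b + 1) / 2 * F a (b + 1 + 1) (d - 1) k l y
    + (a + 1) * (y - a - b) * F (a + 1) b d k l y.

Fact regf_comb c F G : regf_fun (c *: F + G) = c *: regf_fun F + regf_fun G.
Proof. by []. Qed.
Fact regq_comb c F G : regq_fun (c *: F + G) = c *: regq_fun F + regq_fun G.
Proof. by []. Qed.
Fact regz_comb c F G : regz_fun (c *: F + G) = c *: regz_fun F + regz_fun G.
Proof. by []. Qed.
Fact regh_comb c F G : regh_fun (c *: F + G) = c *: regh_fun F + regh_fun G.
Proof. by apply: statesP => *; rewrite statesE /regh_fun !statesE; ring. Qed.
Fact regp_comb c F G : regp_fun (c *: F + G) = c *: regp_fun F + regp_fun G.
Proof. by apply: statesP => *; rewrite statesE /regp_fun !statesE; ring. Qed.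
Fact rege_comb c F G : rege_fun (c *: F + G) = c *: rege_fun F + rege_fun G.
Proof. by apply: statesP => *; rewrite statesE /rege_fun !statesE; ring. Qed.

Definition regf : op := Operator _ regf_comb.
Definition regq : op := Operator _ regq_comb.
Definition regz : op := Operator _ regz_comb.
Definition regh : op := Operator _ regh_comb.
Definition regp : op := Operator _ regp_comb.
Definition rege : op := Operator _ rege_comb.

Lemma regfE F a b d k l y : regf F a b d k l y = F (a - 1) b d k l y.
Proof. by []. Qed.
Lemma regqE F a b d k l y : regq F a b d k l y = F a (b - 1) d k l y.
Proof. by []. Qed.
Lemma regzE F a b d k l y : regz F a b d k l y = F a b (d - 1) k l y.
Proof. by []. Qed.
Lemma reghE F a b d k l y :
  regh F a b d k l y = (y - 2 * a - b) * F a b d k l y.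
Proof. by []. Qed.
Lemma regpE F a b d k l y : regp F a b d k l y = F a b d (k - 1) l (y - 1)
    + (b + 1) * F a (b + 1) (d - 1) k l y
    - (a + 1) * F (a + 1) (b - 1) d k l y.
Proof. by []. Qed.
Lemma regeE F a b d k l y :
  rege F a b d k l y = F a b d k (l - 1) (y - 1 - 1)
    + (b + 1) * F a (b + 1) d (k - 1) l (y - 1)
    + (b + 2) * (b + 1) / 2 * F a (b + 1 + 1) (d - 1) k l y
    + (a + 1) * (y - a - b) * F (a + 1) b d k l y.
Proof. by []. Qed.

Definition regE := (regfE, regqE, regzE, reghE, regpE, regeE).

Local Ltac relation :=
  apply: operatorP => F; apply: statesP => a b d k l y;
  rewrite !opE ?statesE ?regE ?statesE ?regE ?addrK ?subrK;
  by [|field].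

Lemma reg_exists : exists g : {lrmorphism env_alg (schrodinger K) -> op},
  [/\ g (env_inj (sch_e K)) = rege, g (env_inj (sch_h K)) = regh,
      g (env_inj (sch_f K)) = regf & [/\ g (env_inj (sch_p K)) = regp,
      g (env_inj (sch_q K)) = regq & g (env_inj (sch_z K)) = regz]].
Proof.
apply: sch_rep_exists; split; split.
all: relation.
Qed.

End Representations.
Arguments vacuum : clear implicits.

(** * Action of normally ordered monomials on the vacuum *)

Section Kets.
Variable K : numFieldType.
Local Notation op := (endo (vacuum_neq0 K)).

Definition ket (i : nat * nat * nat * nat * nat) (g : {poly K}) : states K :=
  fun a b d k l y => let: (a', b', d', k', l') := i in
  if [&& a == a'%:R, b == b'%:R, d == d'%:R, k == k'%:R & l == l'%:R]
  then g.[y] else 0.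

Lemma vacuumE : vacuum K = ket (0, 0, 0, 0, 0)%N 1.
Proof.
apply: statesP => a b d k l y; rewrite /ket /vacuum hornerC -!andbA.
by rewrite mulrb.
Qed.

Let eqS (x : K) n : (x - 1 == n%:R) = (x == n.+1%:R).
Proof. by rewrite subr_eq natr1. Qed.

Lemma regf_ket a b d k l g :
  regf K (ket (a, b, d, k, l) g) = ket (a.+1, b, d, k, l) g.
Proof. by apply: statesP => *; rewrite regE /ket eqS. Qed.

Lemma regq_ket a b d k l g :
  regq K (ket (a, b, d, k, l) g) = ket (a, b.+1, d, k, l) g.
Proof. by apply: statesP => *; rewrite regE /ket eqS. Qed.

Lemma regz_ket a b d k l g :
  regz K (ket (a, b, d, k, l) g) = ket (a, b, d.+1, k, l) g.
Proof. by apply: statesP => *; rewrite regE /ket eqS. Qed.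

Lemma regh_ket d k l g :
  regh K (ket (0, 0, d, k, l)%N g) = ket (0, 0, d, k, l)%N ('X * g).
Proof.
apply: statesP => a b d' k' l' y; rewrite regE /ket !mulr0n hornerM hornerX.
case: eqP => [->|]; case: eqP => [->|] //=; rewrite ?mulr0 // !subr0.
by case: ifP; rewrite ?mulr0.
Qed.

(** The lowering terms of [regp] survive only where [a + 1] or [b + 1] is 0, and there their
    coefficient vanishes; the same happens in [rege_ket]. *)
Lemma regp_ket d k l :
  regp K (ket (0, 0, d, k, l)%N 1) = ket (0, 0, d, k.+1, l)%N 1.
Proof.
apply: statesP => a b d' k' l' y; rewrite regE /ket !hornerC !eqS !mulr0n.
by case: (eqVneq (a + 1) 0) => [->|] /=; case: (eqVneq (b + 1) 0) => [->|] /=;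
  rewrite ?andbF ?mulr0 ?mul0r ?subr0 ?addr0.
Qed.

Lemma rege_ket d k l :
  rege K (ket (0, 0, d, k, l)%N 1) = ket (0, 0, d, k, l.+1)%N 1.
Proof.
apply: statesP => a b d' k' l' y; rewrite regE /ket !hornerC !eqS !mulr0n.
have -> : b + 2 = b + 1 + 1 by ring.
have if0 (p : bool) (c v : K) : (p -> c = 0) -> c * (if p then v else 0) = 0.
  by case: p => [->|]; rewrite ?mul0r ?mulr0.
rewrite !if0 ?addr0 //; first by case/andP => /eqP-> _; rewrite mul0r.
  by case/and3P => _ /eqP-> _; rewrite ?mul0r.
by case/and3P => _ /eqP-> _; rewrite ?mul0r.
Qed.

(** The factors act from right to left, so [rege] and [regp] meet only kets with polynomial 1 and no
    f or q, and [regh] only kets without f or q. This yields the linear independence of the normal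
    monomials. *)
Lemma pbw_mon_ket i g :
  (pbw_mon (rege K) (regh K) (regf K) (regp K) (regq K) (regz K) i g : op)
    (vacuum K) = ket i g.
Proof.
case: i => [[[[a b] d] k] l]; rewrite [X in op_fun _ X]vacuumE /pbw_mon !opE.
have -> : (rege K ^+ l : op) (ket (0, 0, 0, 0, 0)%N 1)
    = ket (0, 0, 0, 0, l)%N 1.
  by elim: l => // l IH; rewrite exprS opE IH rege_ket.
have -> : (regp K ^+ k : op) (ket (0, 0, 0, 0, l)%N 1)
    = ket (0, 0, 0, k, l)%N 1.
  by elim: k => // k IH; rewrite exprS opE IH regp_ket.
have -> : (horner_alg (regh K) g : op) (ket (0, 0, 0, k, l)%N 1)
    = ket (0, 0, 0, k, l)%N g.
  elim/poly_ind: g => [|g c IH].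
    rewrite rmorph0; apply: statesP => *; rewrite /ket horner0.
    by case: ifP.
  have -> : horner_alg (regh K) (g * 'X + c%:P)
      = regh K * horner_alg (regh K) g + c%:A :> op.
    by rewrite [g * _]mulrC rmorphD rmorphM /= horner_algX horner_algC.
  rewrite opE opE IH regh_ket opE opE; apply: statesP => *.
  rewrite !statesE /ket hornerD !hornerE mulrC.
  by case: ifP => _; rewrite ?mulr1 // mulr0 addr0.
have -> : (regz K ^+ d : op) (ket (0, 0, 0, k, l)%N g)
    = ket (0, 0, d, k, l)%N g.
  by elim: d => // d IH; rewrite exprS opE IH regz_ket.
have -> : (regq K ^+ b : op) (ket (0, 0, d, k, l)%N g)
    = ket (0, b, d, k, l)%N g.
  by elim: b => // b IH; rewrite exprS opE IH regq_ket.
by elim: a => // a IH; rewrite exprS opE IH regf_ket.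
Qed.

End Kets.

Section MorphismImages.
Variables (K : fieldType) (A B : algType K) (phi : {lrmorphism A -> B}).
Variables (E H F P Q Z : A).

Lemma lrmorph_horner_alg x (g : {poly K}) :
  phi (horner_alg x g) = horner_alg (phi x) g.
Proof.
elim/poly_ind: g => [|g c IH]; first by rewrite !rmorph0.
rewrite !rmorphD !rmorphM /= !horner_algX !horner_algC IH.
by rewrite linearZ rmorph1.
Qed.

Lemma lrmorph_casimir : phi (casimir E H F P Q Z) =
  casimir (phi E) (phi H) (phi F) (phi P) (phi Q) (phi Z).
Proof.
by rewrite /casimir !(rmorph_nat, rmorphXn, rmorphB, rmorphM, rmorphD).
Qed.

Lemma lrmorph_pbw_mon i g : phi (pbw_mon E H F P Q Z i g) =
  pbw_mon (phi E) (phi H) (phi F) (phi P) (phi Q) (phi Z) i g.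
Proof.
case: i => [[[[a b] d] k] l]; rewrite /pbw_mon.
rewrite !rmorphM !rmorphXn; congr (_ * (_ * (_ * _ * _ * _))).
exact: lrmorph_horner_alg.
Qed.

End MorphismImages.

Section KetSums.
Variable K : numFieldType.
Local Notation index := (nat * nat * nat * nat * nat)%type.

Lemma states_sumE (I : Type) (s : seq I) (X : I -> states K) a b d k l y :
  (\sum_(i <- s) X i) a b d k l y = \sum_(i <- s) X i a b d k l y.
Proof. by elim: s => [|i s IH]; rewrite ?big_nil // !big_cons statesE IH. Qed.

Variables (s : seq index) (G : index -> {poly K}).
Hypothesis s_uniq : uniq s.

Definition ket_sum : states K := \sum_(i <- s) ket i (G i).

Definition ket_coef (i : index) := if i \in s then G i else 0.

Lemma ket_sum_nat a b d k l y :
  ket_sum a%:R b%:R d%:R k%:R l%:R y = (ket_coef (a, b, d, k, l)).[y].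
Proof.
rewrite /ket_sum states_sumE /ket_coef.
have ketE j : ket j (G j) a%:R b%:R d%:R k%:R l%:R y =
    if j == (a, b, d, k, l) then (G j).[y] else 0.
  case: j => [[[[a' b'] d'] k'] l']; rewrite /ket !eqr_nat.
  case: ifP => [/and5P[/eqP-> /eqP-> /eqP-> /eqP-> /eqP->]|].
    by rewrite eqxx.
  by case: (_ =P (a, b, d, k, l)) => // -[-> -> -> -> ->]; rewrite !eqxx.
rewrite (eq_bigr _ (fun j _ => ketE j)) -big_mkcond /=.
case: ifP => is_; last first.
  rewrite horner0 big1_seq // => j /andP[/eqP-> ]; by rewrite is_.
by rewrite -big_filter filter_pred1_uniq // big_seq1.
Qed.

Lemma ket_sum_neq0 a b d k l y : ket_sum a b d k l y != 0 ->
  [/\ exists n, a = n%:R, exists n, b = n%:R, exists n, d = n%:R,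
      exists n, k = n%:R & exists n, l = n%:R].
Proof.
rewrite /ket_sum states_sumE; elim: s => [|[[[[a' b'] d'] k'] l'] t IH].
  by rewrite big_nil eqxx.
rewrite big_cons {1}/ket; case: ifP => [/and5P[] |_]; last by rewrite add0r.
do 5!move=> /eqP->; by split; eexists.
Qed.

Lemma ket_coef_fin : exists N, forall a b d k l, (N <= a)%N || (N <= d)%N ->
  ket_coef (a, b, d, k, l) = 0.
Proof.
pose m (i : index) := let: (a, b, d, k, l) := i in maxn a d.
exists (\max_(i <- s) m i).+1 => a b d k l; rewrite /ket_coef.
case: ifP => // is_; have := @leq_bigmax_seq _ s xpredT m _ is_ isT.
rewrite geq_max => /andP[am dm]; rewrite !ltnNge am dm //.
Qed.

End KetSums.

(** * Right multiplication, commuting with the regular representation *)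

Section RightMultiplication.
Variable K : numFieldType.
Local Notation op := (endo (vacuum_neq0 K)).

(* Right multiplication by p, e and h on coefficients. *)
Definition rightp_fun (F : states K) : states K :=
  fun a b d k l y => F a b d (k - 1) l y.
Definition righte_fun (F : states K) : states K :=
  fun a b d k l y => F a b d k (l - 1) y.
Definition righth_fun (F : states K) : states K :=
  fun a b d k l y => (y - k - 2 * l) * F a b d k l y.

Fact rightp_comb c F G :
  rightp_fun (c *: F + G) = c *: rightp_fun F + rightp_fun G.
Proof. by []. Qed.
Fact righte_comb c F G :
  righte_fun (c *: F + G) = c *: righte_fun F + righte_fun G.
Proof. by []. Qed.
Fact righth_comb c F G :
  righth_fun (c *: F + G) = c *: righth_fun F + righth_fun G.
Proof. by apply: statesP => *; rewrite statesE /righth_fun !statesE; ring. Qed.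

Definition rightp : op := Operator _ rightp_comb.
Definition righte : op := Operator _ righte_comb.
Definition righth : op := Operator _ righth_comb.

Lemma rightpE F a b d k l y : rightp F a b d k l y = F a b d (k - 1) l y.
Proof. by []. Qed.
Lemma righteE F a b d k l y : righte F a b d k l y = F a b d k (l - 1) y.
Proof. by []. Qed.
Lemma righthE F a b d k l y :
  righth F a b d k l y = (y - k - 2 * l) * F a b d k l y.
Proof. by []. Qed.
Definition rightE := (rightpE, righteE, righthE).

Lemma right_comm (R S : op) : R \in [:: righte; righth; rightp] ->
  S \in [:: rege K; regh K; regf K; regp K; regq K; regz K] -> GRing.comm R S.
Proof.
rewrite !inE => /or3P RE /or4P SE; case: RE => /eqP->;
  case: SE => [/eqP->|/eqP->|/eqP->|/or3P[/eqP->|/eqP->|/eqP->]];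
  apply: operatorP => F; apply: statesP => a b d k l y;
  by rewrite !opE ?regE ?rightE ?regE ?rightE; try ring.
Qed.

Lemma right_vacuum : [/\ rege K (vacuum K) = righte (vacuum K),
  regh K (vacuum K) = righth (vacuum K)
  & regp K (vacuum K) = rightp (vacuum K)].
Proof.
have eqS (x : K) n : (x - 1 == n%:R) = (x == n.+1%:R) by rewrite subr_eq natr1.
split; rewrite ![X in op_fun _ X]vacuumE.
- rewrite rege_ket; apply: statesP => a b d k l y.
  by rewrite rightE vacuumE /ket eqS.
- rewrite regh_ket; apply: statesP => a b d k l y.
  rewrite rightE vacuumE /ket hornerM hornerX; case: ifP; rewrite ?mulr0 //.
  by case/and5P => _ _ _ /eqP-> /eqP->; rewrite mulr0 !subr0.
rewrite regp_ket; apply: statesP => a b d k l y.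
by rewrite rightE vacuumE /ket eqS.
Qed.

End RightMultiplication.

(** A tuple of rewrite rules; the indices keep the forms [0 - 1] and [0 - 1 - 1] in which the
    operator formulas produce them. *)
Definition zero_below (K : numFieldType) (F : states K) : Prop :=
  ((forall b d k l y, F (0 - 1) b d k l y = 0)
  * (forall a d k l y, F a (0 - 1) d k l y = 0)
  * (forall a d k l y, F a (0 - 1 - 1) d k l y = 0)
  * (forall a b d l y, F a b d (0 - 1) l y = 0)
  * (forall a b d k y, F a b d k (0 - 1) y = 0))%type.

Section HarishChandraCasimir.
Variable K : numFieldType.
Local Notation op := (endo (vacuum_neq0 K)).
Variable F : states K.
Hypothesis F_neg : zero_below F.

(** In normal order 2 e q^2 contributes 2z and 2 h p q contributes 2hz, which with (h^2 + h) z make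
    (h+1)(h+2) z. Every other term starts with f or q and gives nothing at [a = b = 0]. *)
Lemma hc_casimir d y : 
  (casimir (rege K) (regh K) (regf K) (regp K) (regq K) (regz K) : op) F
    0 0 d 0 0 y = (y + 1) * (y + 2) * F 0 0 (d - 1) 0 0 y.
Proof.
rewrite /casimir -[4]/(1 *+ 4) -[2]/(1 *+ 2) !mulr_natl !mulrS !mulr0n !addr0.
rewrite !expr2 !opE.
rewrite !statesE.
rewrite !regE.
rewrite ?addrK ?subrK !F_neg.
by field.
Qed.
End HarishChandraCasimir.

(* The operators p = x, q = y, e = x d/dy, h = x d/dx - y d/dy and
   f = y d/dx + t x^-2 on Laurent series, in terms of the coefficients of x^m y^n;
   the otherwise unused index d serves as the scalar t. *)
Section ZeroCharge.
Variable K : numFieldType.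
Local Notation op := (endo (vacuum_neq0 K)).

Definition nullf_fun (F : states K) : states K := fun m n d k l y =>
  (m + 1) * F (m + 1) (n - 1) d k l y + d * F (m + 1 + 1) n d k l y.
Definition nulle_fun (F : states K) : states K := fun m n d k l y =>
  (n + 1) * F (m - 1) (n + 1) d k l y.
Definition nullh_fun (F : states K) : states K := fun m n d k l y =>
  (m - n) * F m n d k l y.
Definition nullp_fun (F : states K) : states K := fun m n d k l y =>
  F (m - 1) n d k l y.
Definition nullq_fun (F : states K) : states K := fun m n d k l y =>
  F m (n - 1) d k l y.

Fact nullf_comb c F G : nullf_fun (c *: F + G) = c *: nullf_fun F + nullf_fun G.
Proof. by apply: statesP => *; rewrite statesE /nullf_fun !statesE; ring. Qed.
Fact nulle_comb c F G : nulle_fun (c *: F + G) = c *: nulle_fun F + nulle_fun G.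
Proof. by apply: statesP => *; rewrite statesE /nulle_fun !statesE; ring. Qed.
Fact nullh_comb c F G : nullh_fun (c *: F + G) = c *: nullh_fun F + nullh_fun G.
Proof. by apply: statesP => *; rewrite statesE /nullh_fun !statesE; ring. Qed.
Fact nullp_comb c F G : nullp_fun (c *: F + G) = c *: nullp_fun F + nullp_fun G.
Proof. by []. Qed.
Fact nullq_comb c F G : nullq_fun (c *: F + G) = c *: nullq_fun F + nullq_fun G.
Proof. by []. Qed.

Definition nullf : op := Operator _ nullf_comb.
Definition nulle : op := Operator _ nulle_comb.
Definition nullh : op := Operator _ nullh_comb.
Definition nullp : op := Operator _ nullp_comb.
Definition nullq : op := Operator _ nullq_comb.

Lemma nullfE F m n d k l y : nullf F m n d k l y =
  (m + 1) * F (m + 1) (n - 1) d k l y + d * F (m + 1 + 1) n d k l y.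
Proof. by []. Qed.
Lemma nulleE F m n d k l y :
  nulle F m n d k l y = (n + 1) * F (m - 1) (n + 1) d k l y.
Proof. by []. Qed.
Lemma nullhE F m n d k l y : nullh F m n d k l y = (m - n) * F m n d k l y.
Proof. by []. Qed.
Lemma nullpE F m n d k l y : nullp F m n d k l y = F (m - 1) n d k l y.
Proof. by []. Qed.
Lemma nullqE F m n d k l y : nullq F m n d k l y = F m (n - 1) d k l y.
Proof. by []. Qed.
Definition nullE := (nullfE, nulleE, nullhE, nullpE, nullqE).

Lemma null_exists : exists g : {lrmorphism env_alg (schrodinger K) -> op},
  [/\ g (env_inj (sch_e K)) = nulle, g (env_inj (sch_h K)) = nullh,
      g (env_inj (sch_f K)) = nullf & [/\ g (env_inj (sch_p K)) = nullp,
      g (env_inj (sch_q K)) = nullq & g (env_inj (sch_z K)) = 0]].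
Proof.
apply: sch_rep_exists; split; split; rewrite ?mulr0 ?mul0r //.
all: apply: operatorP => F; apply: statesP => m n d k l y.
all: rewrite !opE ?statesE ?nullE ?statesE ?nullE ?statesE ?addrK ?subrK.
all: by [|ring].
Qed.

(** For z = 0 the differential operators without t cancel in f p^2 - e q^2 - h p q; what remains is
    t x^-2 x^2 = t, with factor -2. *)
Lemma null_casimir F m n d k l y :
  (casimir nulle nullh nullf nullp nullq 0 : op) F m n d k l y
  = - 2 * d * F m n d k l y.
Proof.
rewrite /casimir mulr0 sub0r mulrDl mul1r !expr2 !opE !statesE !nullE !addrK.
rewrite ?subrK.
by ring.
Qed.

End ZeroCharge.

(** * Coefficients of central elements *)

Section PolynomialIdentities.
Variable K : numFieldType.
Implicit Types p : {poly K}.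

Lemma poly_zeros_nat p (c : nat -> K) : injective c ->
  (forall n, p.[c n] = 0) -> p = 0.
Proof.
move=> cI p0; apply/eqP; apply: contraT => pn0.
have := @max_poly_roots _ p [seq c n | n <- iota 0 (size p)] pn0.
rewrite map_inj_uniq // iota_uniq size_map size_iota ltnn => -> //.
by apply/allP => _ /mapP[n _ ->]; apply/rootP.
Qed.

Lemma poly_fun0 p : (forall y, p.[y] = 0) -> p = 0.
Proof.
move=> p0; apply: (@poly_zeros_nat p (fun n => n%:R)) => // m n /eqP.
by rewrite eqr_nat => /eqP.
Qed.

Lemma poly_mul_fun0 p c : (forall y, (y - c) * p.[y] = 0) -> p = 0.
Proof.
move=> p0; have : ('X - c%:P) * p = 0.
  by apply: poly_fun0 => y; rewrite hornerM hornerXsubC.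
by move/eqP; rewrite mulf_eq0 polyXsubC_eq0 => /eqP.
Qed.

(** The root [c] propagates to all [c - 2n], which are distinct in characteristic 0. *)
Lemma poly_periodic0 p c :
  (forall y, p.[y] = p.[y - 1 - 1]) -> p.[c] = 0 -> p = 0.
Proof.
move=> pp pc; apply: (@poly_zeros_nat p (fun n => c - n.*2%:R)).
  by move=> m n /addrI/oppr_inj/eqP; rewrite eqr_nat => /eqP/double_inj.
elim=> [|n IH]; first by rewrite subr0.
by rewrite doubleS -IH [RHS]pp -!natr1 !opprD !addrA.
Qed.

(** The reflection exchanges -1 and -2, so p - p(-1) vanishes at both and is divisible by T =
    (X+1)(X+2). As T is itself invariant, so is the quotient, and induction on the size applies. *)
Lemma poly_symmetric p : (forall y, p.[y] = p.[- 3 - y]) ->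
  exists s : {poly K}, p = s \Po (('X + 1) * ('X + 2)).
Proof.
elim: {p}(size p) {-2}p (leqnn (size p)) => [|n IH] p.
  rewrite leqn0 size_poly_eq0 => /eqP-> _; exists 0.
  by rewrite comp_poly0.
move=> szp psym; pose p1 := p - (p.[-1])%:P.
have r1 : root p1 (-1) by rewrite /root !hornerE subrr.
have r2 : root p1 (-2).
  rewrite /root !hornerE psym; have -> : -3 - -2 = -1 :> K by ring.
  by rewrite subrr.
have [u def1] : exists u, p1 = u * (('X + 1) * ('X + 2)).
  have /factor_theorem[v defv] := r1.
  have : root v (-2).
    move: r2; rewrite defv rootM => /orP[//|]; rewrite root_XsubC => /eqP/eqP.
    by rewrite eqr_opp (eqr_nat K 2 1).
  move=> /factor_theorem[u defu]; exists u; rewrite defv defu !rmorphN /=.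
  by rewrite !opprK -mulrA [('X + 2%:P) * _]mulrC polyC_natr.
set T := ('X + 1) * ('X + 2) in def1 *.
have TE y : T.[y] = (y + 1) * (y + 2).
  by rewrite /T -polyC1 -(polyC_natr K 2) !hornerE.
have T3 : size T = 3.
  rewrite /T -polyC1 -(polyC_natr K 2) size_mul ?size_XaddC //;
    by rewrite -size_poly_eq0 size_XaddC.
have T0 : T != 0 by rewrite -size_poly_eq0 T3.
have p1E : p = u * T + (p.[-1])%:P by rewrite -def1 subrK.
have pE y : p.[y] = u.[y] * T.[y] + p.[-1].
  by rewrite {1}p1E hornerD hornerM hornerC.
have usym y : u.[y] = u.[-3 - y].
  have : (u - (u \Po ((-3)%:P - 'X))) * T = 0.
    apply: poly_fun0 => {}y; have := psym y.
    rewrite (pE y) (pE (-3 - y)) !TE => /addIr uT.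
    rewrite hornerM TE hornerD hornerN horner_comp hornerD hornerN hornerX.
    by rewrite hornerC mulrBl uT; ring.
  move/eqP; rewrite mulf_eq0 (negPf T0) orbF subr_eq0 => /eqP uE.
  by rewrite {1}uE horner_comp hornerD hornerN hornerX hornerC.
have szu : (size u <= n)%N.
  have [->|u0] := eqVneq u 0; first by rewrite size_poly0.
  have : (size p1 <= n.+1)%N.
    rewrite (leq_trans (size_polyD _ _)) // size_polyN geq_max szp.
    by rewrite (leq_trans (size_polyC_leq1 _)).
  by rewrite def1 size_mul // T3 addn3 /= ltnS => /ltnW.
have [s uE] := IH u szu usym; exists (s * 'X + (p.[-1])%:P).
by rewrite comp_polyD comp_polyM comp_polyX comp_polyC -uE -p1E.
Qed.

End PolynomialIdentities.

(** * Recurrences for coefficients that commute with h, p and e *)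

Section CentralStates.
Variables (K : numFieldType) (F : states K).
Variables (G : nat * nat * nat * nat * nat -> {poly K}) (N : nat).

Hypothesis FG : forall a b d k l y,
  F a%:R b%:R d%:R k%:R l%:R y = (G (a, b, d, k, l)).[y].
Hypothesis F_nat : forall a b d k l y, F a b d k l y != 0 ->
  [/\ exists n, a = n%:R, exists n, b = n%:R, exists n, d = n%:R,
      exists n, k = n%:R & exists n, l = n%:R].
Hypothesis G_fin : forall a b d k l,
  (N <= a)%N || (N <= d)%N -> G (a, b, d, k, l) = 0.
Hypothesis F_weight : forall a b d k l y,
  (y - 2 * a - b) * F a b d k l y = (y - k - 2 * l) * F a b d k l y.
Hypothesis F_p : forall a b d k l y,
  regp K F a b d k l y = F a b d (k - 1) l y.
Hypothesis F_e : forall a b d k l y,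
  rege K F a b d k l y = F a b d k (l - 1) y.

Lemma F_neg : zero_below F.
Proof.
have neg1 n : (0 - 1 = n%:R :> K) -> False.
  by move/eqP; rewrite sub0r eq_sym -subr_eq0 opprK natr1 pnatr_eq0.
have neg2 n : (0 - 1 - 1 = n%:R :> K) -> False.
  by move/eqP; rewrite subr_eq natr1 => /eqP/neg1.
do !split=> *; apply/eqP; apply: contraT => /F_nat[[? ?] [? ?] _ [? ?] [? ?]];
  by exfalso; first [eapply neg1; eassumption | eapply neg2; eassumption].
Qed.

Lemma F_poly a b d k l : exists p : {poly K}, forall y, F a b d k l y = p.[y].
Proof.
have [[y0 /eqP/F_nat]|F0] := pselect (exists y, F a b d k l y <> 0).
  by case=> [[? ->] [? ->] [? ->] [? ->] [? ->]]; eexists; apply: FG.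
exists 0 => y; rewrite horner0; apply: contrapT => Fy; apply: F0; by exists y.
Qed.

Lemma F_mul0 a b d k l (c x : K) y : c != 0 ->
  (forall y, c * (y - x) * F a b d k l y = 0) -> F a b d k l y = 0.
Proof.
move=> c0 F0; have [p pE] := F_poly a b d k l.
rewrite pE (@poly_mul_fun0 _ p x) ?horner0 // => y'.
by apply: (mulfI c0); rewrite mulr0 mulrA -pE.
Qed.

Let natrB1 n : n.+1%:R - 1 = n%:R :> K.
Proof. by rewrite -natr1 addrK. Qed.

Let Fp (a b : nat) d k l y :
  F a%:R b%:R d (k - 1) l (y - 1) + b.+1%:R * F a%:R b.+1%:R (d - 1) k l y
  - a.+1%:R * F a.+1%:R (b%:R - 1) d k l y = F a%:R b%:R d (k - 1) l y.
Proof. by rewrite -[RHS]F_p regE !natr1. Qed.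

Let Fe (a b : nat) d k l y :
  F a%:R b%:R d k (l - 1) (y - 1 - 1)
  + b.+1%:R * F a%:R b.+1%:R d (k - 1) l (y - 1)
  + b.+2%:R * b.+1%:R / 2 * F a%:R b.+2%:R (d - 1) k l y
  + a.+1%:R * (y - a%:R - b%:R) * F a.+1%:R b%:R d k l y
  = F a%:R b%:R d k (l - 1) y.
Proof. by rewrite -[RHS]F_e regE !natr1 -natrD addn2. Qed.

(** Induction on 2a + b, the weight removed by f^a q^b. For a = b = 0 the weight condition reads (k
    + 2l) F = 0, which leaves only k = l = 0, the hypothesis. *)
Lemma central_state0 : (forall d y, F 0 0 d 0 0 y = 0) ->
  forall a b d k l y, F a b d k l y = 0.
Proof.
move=> F0.
suff F0n n : forall a b : nat, (2 * a + b <= n)%N ->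
    forall d k l y, F a%:R b%:R d k l y = 0.
  move=> a b d k l y; apply/eqP; apply: contraT.
  move=> /[dup] /F_nat[[a' ->] [b' ->] _ _ _].
  by rewrite (F0n _ a' b' (leqnn _)) eqxx.
elim: n => [|n IH] a b.
  case: a b => [|a] [|b]; rewrite ?muln0 ?mulnS //= => _ d k l y.
  apply/eqP; apply: contraT => /[dup] Fn0 /F_nat[_ _ _ [k' kE] [l' lE]].
  have : (k + 2 * l) * F 0 0 d k l y = 0.
    have := F_weight 0 0 d k l y; rewrite mulr0 !subr0 => /eqP.
    by rewrite -subr_eq0 -mulrBl => /eqP; apply: etrans; congr (_ * _); ring.
  move/eqP; rewrite mulf_eq0 (negPf Fn0) orbF kE lE -natrM -natrD pnatr_eq0.
  rewrite addn_eq0 muln_eq0 /= => /andP[/eqP k0 /eqP l0].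
  by move: Fn0; rewrite kE lE k0 l0 F0 eqxx.
rewrite leq_eqVlt => /orP[/eqP|]; last by rewrite ltnS; apply: IH.
(* The p-recurrence at (a', b'+1) and the e-recurrence at (a', b') both involve the coefficient at
   (a', b'+2); eliminating it leaves a nonzero multiple of [y - x] times the wanted coefficient. *)
have claim1 a' b' : (2 * a'.+1 + b' = n.+1)%N -> forall d k l y,
    F a'.+1%:R b'%:R d k l y = 0.
  move=> ab d k l y.
  pose x : K := a'%:R + b'%:R - b'.+1%:R / 2.
  apply: (@F_mul0 _ _ _ _ _ a'.+1%:R x) => [|y']; rewrite /x {x}.
    by rewrite pnatr_eq0.
  have := Fp a' b'.+1 d k l y'; have := Fe a' b' d k l y'.
  rewrite natrB1 !(IH a' b'.+1) ?(IH a' b'); [|lia..].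
  rewrite mulr0 !add0r => Ee /eqP; rewrite subr_eq0 => /eqP Ep.
  rewrite -[RHS]Ee [b'.+2%:R * _]mulrC -!mulrA [b'.+2%:R * _]mulrCA Ep.
  by ring.
case: a => [|a]; last by move=> ab d k l y; apply: claim1.
case: b => [|b] // nb d k l y.
(* With a = 0 the p-recurrence expresses the coefficient of q^(b+1) through that of f q^(b-1), which
   is 0 by [claim1] or has a negative exponent. *)
have := Fp 0 b (d + 1) k l y; rewrite !(IH 0%N b); [|lia..].
rewrite addrK add0r mul1r.
have -> : F 1 (b%:R - 1) (d + 1) k l y = 0.
  case: b nb => [|b] nb; first by rewrite F_neg.
  by rewrite natrB1; apply: (claim1 0%N); lia.
by rewrite subr0 => /eqP; rewrite mulf_eq0 pnatr_eq0 => /eqP.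
Qed.

(** The e-recurrence at (n, 0) contains the coefficient of f^n q^2 e^(n+1), which the p-recurrence
    at (n, 1) expresses through that of f^(n+1) e^(n+1). *)
Lemma leading_step (n : nat) d y :
  F n%:R 0 d 0 n%:R y - F n%:R 0 d 0 n%:R (y - 1 - 1)
  = n.+1%:R * (y - n%:R + 2^-1) * F n.+1%:R 0 d 0 n.+1%:R y.
Proof.
have := Fe n 0 d 0 n.+1%:R y; have := Fp n 1 d 0 n.+1%:R y.
rewrite !F_neg !natrB1 add0r => /eqP; rewrite subr_eq0 => /eqP Ep <-.
rewrite mulr0 addr0 mulr1 divff ?pnatr_eq0 //.
have -> : F n%:R 2 (d - 1) 0 n.+1%:R y
    = 2^-1 * (2 * F n%:R 2 (d - 1) 0 n.+1%:R y) by rewrite mulKf ?pnatr_eq0.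
by rewrite Ep; ring.
Qed.

(** Under y -> 2n - 1 - y the factor y - n + 1/2 of [leading_step] changes sign, while the
    coefficient for n + 1 is invariant by induction. Hence the defect [D] of the symmetry has period
    2. *)
Lemma leading_symmetric (n : nat) d y :
  F n%:R 0 d 0 n%:R y = F n%:R 0 d 0 n%:R (2 * n%:R - 3 - y).
Proof.
have [m] := ubnP (N - n); elim: m n y => [|m IH] n y //.
rewrite ltnS => le_m; have [Nn|nN] := leqP N n.
  have F0 y' : F n%:R 0 d 0 n%:R y' = 0.
    apply/eqP; apply: contraT => /[dup] Fn0 /F_nat[_ _ [d' dE] _ _].
    by move: Fn0; rewrite dE (FG n 0 d' 0 n) G_fin ?Nn ?horner0 ?eqxx.
  by rewrite !F0.
have [P PE] := F_poly n%:R 0 d 0 n%:R.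
have step y' : P.[y'] - P.[y' - 1 - 1]
    = n.+1%:R * (y' - n%:R + 2^-1) * F n.+1%:R 0 d 0 n.+1%:R y'.
  by rewrite -!PE leading_step.
have sym y' : F n.+1%:R 0 d 0 n.+1%:R y' =
    F n.+1%:R 0 d 0 n.+1%:R (2 * n.+1%:R - 3 - y').
  by apply: IH; lia.
pose D := P - (P \Po ((2 * n%:R - 3)%:P - 'X)).
have DE y' : D.[y'] = P.[y'] - P.[2 * n%:R - 3 - y'].
  by rewrite /D hornerD hornerN horner_comp hornerD hornerN hornerX hornerC.
have D0 : D = 0.
  (* The fixed point of y -> 2n - 3 - y, where [D] vanishes trivially. *)
  apply: (@poly_periodic0 _ D (n%:R - 3 / 2)) => [y'|]; rewrite !DE.
    have -> : 2 * n%:R - 3 - (y' - 1 - 1) = 2 * n%:R - 3 - y' + 1 + 1 by ring.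
    have := step (2 * n%:R - 3 - y' + 1 + 1); have := step y'.
    have sym' : F n.+1%:R 0 d 0 n.+1%:R y'
        = F n.+1%:R 0 d 0 n.+1%:R (2 * n%:R - 3 - y' + 1 + 1).
      by rewrite sym -natr1; congr (F _ _ _ _ _ _); ring.
    rewrite -sym' !addrK => E1 E2; apply/eqP; rewrite -subr_eq0; apply/eqP.
    transitivity ((P.[y'] - P.[y' - 1 - 1])
       + (P.[2 * n%:R - 3 - y' + 1 + 1] - P.[2 * n%:R - 3 - y'])).
      by ring.
    by rewrite E1 E2; field.
  by apply/eqP; rewrite subr_eq0; apply/eqP; congr (_.[_]); field.
have := DE y; rewrite D0 horner0 => /eqP; rewrite eq_sym subr_eq0 => /eqP.
by rewrite !PE.
Qed.

End CentralStates.

(** * Polynomials in z and c *)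

Section PolynomialSpan.
Variables (K : fieldType) (A : algType K) (z c : A).
Hypothesis zc : GRing.comm z c.

(** A Horner scheme in z with coefficients in K[c]; the term free of z is the head of the list,
    ready to be split off in [descent]. *)
Definition zc_eval (s : seq {poly K}) : A :=
  foldr (fun g u => horner_alg c g + z * u) 0 s.

Definition zc_gen (u : A) : Prop := exists s, u = zc_eval s.

Lemma zc_gen0 : zc_gen 0.
Proof. by exists [::]. Qed.

Lemma zc_genD u v : zc_gen u -> zc_gen v -> zc_gen (u + v).
Proof.
move=> [s ->] [t ->]; elim: s t => [|g s IH] t.
  by exists t; rewrite add0r.
case: t => [|g' t]; first by exists (g :: s); rewrite addr0.
have [r rE] := IH t; exists (g + g' :: r).
by rewrite /= rmorphD addrACA -mulrDr rE.
Qed.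

Lemma zc_gen1 : zc_gen 1.
Proof. by exists [:: 1]; rewrite /= rmorph1 mulr0 addr0. Qed.

Lemma zc_genZ a u : zc_gen u -> zc_gen (a *: u).
Proof.
move=> [s ->]; exists [seq a *: g | g <- s]; elim: s => [|g s IH] /=.
  by rewrite scaler0.
rewrite scalerDr scalerAr IH -mul_polyC rmorphM /= horner_algC.
by rewrite -scalerAl mul1r.
Qed.

Lemma zc_genMz u : zc_gen u -> zc_gen (z * u).
Proof. by move=> [s ->]; exists (0 :: s); rewrite /= rmorph0 add0r. Qed.

Lemma zc_genMc u : zc_gen u -> zc_gen (c * u).
Proof.
move=> [s ->]; exists [seq 'X * g | g <- s]; elim: s => [|g s IH] /=.
  by rewrite mulr0.
by rewrite mulrDr mulrA -zc -mulrA IH rmorphM /= horner_algX.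
Qed.

Lemma zc_gen_mon i j : zc_gen (c ^+ i * z ^+ j).
Proof.
elim: i => [|i IH]; last by rewrite exprS -mulrA; apply: zc_genMc.
rewrite mul1r; elim: j => [|j IH]; first exact: zc_gen1.
by rewrite exprS; apply: zc_genMz.
Qed.

Lemma zc_gen_sum (I : Type) (r : seq I) (F : I -> A) :
  (forall i, zc_gen (F i)) -> zc_gen (\sum_(i <- r) F i).
Proof. by move=> GF; apply: big_ind => //; [apply: zc_gen0|apply: zc_genD]. Qed.

Lemma zc_gen_subalg (B : {pred A}) :
  GRing.subalg_closed B -> z \in B -> c \in B -> forall u, zc_gen u -> u \in B.
Proof.
move=> [B1 Blin BM] Bz Bc _ [s ->].
have B0 : 0 \in B by rewrite -(addNr 1) -scaleN1r; apply: Blin.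
have BD u v : u \in B -> v \in B -> u + v \in B.
  by move=> Bu Bv; rewrite -[u]scale1r; apply: Blin.
elim: s => [|g s IH] //=; apply: (BD); last exact: BM.
elim/poly_ind: g => [|g a IHg]; first by rewrite rmorph0.
rewrite rmorphD rmorphM /= horner_algX horner_algC; apply: BD; first exact: BM.
by rewrite -[_ *: _]addr0; apply: Blin.
Qed.

End PolynomialSpan.

Section OperatorSums.
Variables (K : fieldType) (V : lmodType K) (v : V) (nz : v != 0).

Lemma op_sumE (I : Type) (r : seq I) (S : I -> endo nz) F :
  (\sum_(i <- r) S i) F = \sum_(i <- r) S i F.
Proof. by elim: r => [|i r IH]; rewrite ?big_nil // !big_cons opE IH. Qed.

End OperatorSums.

(** * Central elements are polynomials in z and c *)

Section Center.
Variables (K : numFieldType) (A : algType K) (E H F P Q Z : A).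
Local Notation op := (endo (vacuum_neq0 K)).
Local Notation C := (casimir E H F P Q Z).

Hypothesis rel : sch_relations E H F P Q Z.
Hypothesis A_ind : forall T : A -> Prop, T 1 ->
    (forall c x y, T x -> T y -> T (c *: x + y)) ->
    (forall g, g \in [:: E; H; F; P; Q; Z] -> forall x, T x -> T (g * x)) ->
  forall x, T x.

Variable phi : {lrmorphism A -> op}.
Hypotheses (phiE : phi E = rege K) (phiH : phi H = regh K)
  (phiF : phi F = regf K) (phiP : phi P = regp K) (phiQ : phi Q = regq K)
  (phiZ : phi Z = regz K).

Variable psi : {lrmorphism A -> op}.
Hypotheses (psiE : psi E = nulle K) (psiH : psi H = nullh K)
  (psiF : psi F = nullf K) (psiP : psi P = nullp K) (psiQ : psi Q = nullq K)
  (psiZ : psi Z = 0).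

Definition orbit (x : A) : states K := phi x (vacuum K).

Lemma orbitM x y : orbit (x * y) = phi x (orbit y).
Proof. by rewrite /orbit rmorphM opE. Qed.

Lemma orbitB x y : orbit (x - y) = orbit x - orbit y.
Proof. by rewrite /orbit rmorphB !opE. Qed.

Lemma orbitZ c x : orbit (c *: x) = c *: orbit x.
Proof. by rewrite /orbit linearZ opE. Qed.

Lemma orbit_sum (I : Type) (r : seq I) (X : I -> A) :
  orbit (\sum_(i <- r) X i) = \sum_(i <- r) orbit (X i).
Proof. by rewrite /orbit rmorph_sum op_sumE. Qed.

Lemma orbit_ket_sum x : exists s G, [/\ uniq s,
  x = \sum_(i <- s) pbw_mon E H F P Q Z i (G i) & orbit x = ket_sum s G].
Proof.
have [|s [G [us xE]]] := @pbw_span_normal _ _ E H F P Q Z x.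
  move: x; apply: A_ind;
    [exact: pbw_span1 | exact: pbw_span_comb | exact: pbw_span_mull].
exists s, G; split=> //; rewrite xE orbit_sum; apply: eq_bigr => i _.
by rewrite /orbit lrmorph_pbw_mon phiE phiH phiF phiP phiQ phiZ pbw_mon_ket.
Qed.

(** Applying x to the vacuum reads off every polynomial of its normal form, so all of them
    vanish. *)
Lemma orbit_eq0 x : orbit x = 0 -> x = 0.
Proof.
have [s [G [us -> ->]]] := orbit_ket_sum x => W0.
rewrite big_seq big1 // => -[[[[a b] d] k] l] is_.
have -> : G (a, b, d, k, l) = 0.
  apply: poly_fun0 => y.
  have := ket_sum_nat G us a b d k l y; rewrite /ket_coef is_ => <-.
  by rewrite W0.
by rewrite /pbw_mon rmorph0 mulr0 !mul0r !mulr0.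
Qed.

Lemma orbit_neg x : zero_below (orbit x).
Proof.
have [s [G [us _ XE]]] := orbit_ket_sum x.
by apply: F_neg => a b d k l y; rewrite XE; apply: ket_sum_neq0.
Qed.

Lemma right_phi (R : op) : R \in [:: righte K; righth K; rightp K] ->
  forall x, GRing.comm R (phi x).
Proof.
move=> Rin; apply: A_ind => [|c x y Rx Ry|g gin x Rx].
- by rewrite rmorph1; apply: commr1.
- by rewrite linearP; apply: comm_comb.
rewrite rmorphM; apply: commrM => //; apply: right_comm => //.
move: gin; rewrite -phiE -phiH -phiF -phiP -phiQ -phiZ !inE.
by move=> /or4P[/eqP->|/eqP->|/eqP->|/or3P[/eqP->|/eqP->|/eqP->]];
  rewrite eqxx ?orbT.
Qed.

(** Writing 1 for the vacuum: g.(x.1) = (gx).1 = (xg).1 = x.(g.1) = x.(R 1) = R (x.1). *)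
Lemma orbit_right x g (R : op) : R \in [:: righte K; righth K; rightp K] ->
    phi g (vacuum K) = R (vacuum K) -> GRing.comm x g ->
  phi g (orbit x) = R (orbit x).
Proof.
move=> Rin gR xg; rewrite -orbitM -xg orbitM /orbit gR.
exact: esym (congr1 (fun T : op => T (vacuum K)) (right_phi Rin x)).
Qed.

Lemma central_orbit x : (forall y, GRing.comm x y) ->
  [/\ forall a b d k l y,
        rege K (orbit x) a b d k l y = orbit x a b d k (l - 1) y,
      forall a b d k l y,
        regp K (orbit x) a b d k l y = orbit x a b d (k - 1) l y
    & forall a b d k l y, (y - 2 * a - b) * orbit x a b d k l y
                          = (y - k - 2 * l) * orbit x a b d k l y].
Proof.
move=> xc; have [vE vH vP] := right_vacuum K.
split=> a b d k l y.
- rewrite -rightE -phiE (@orbit_right x E (righte K)) ?inE ?eqxx ?orbT //.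
  by rewrite phiE.
- rewrite -rightE -phiP (@orbit_right x P (rightp K)) ?inE ?eqxx ?orbT //.
  by rewrite phiP.
rewrite -rightE -reghE -phiH (@orbit_right x H (righth K)) ?inE ?eqxx ?orbT //.
by rewrite phiH.
Qed.

Lemma central_orbit0 x : (forall y, GRing.comm x y) ->
  (forall d y, orbit x 0 0 d 0 0 y = 0) -> x = 0.
Proof.
move=> xc x0; apply: orbit_eq0; have [xe xp xh] := central_orbit xc.
have [s [G [us _ XE]]] := orbit_ket_sum x.
apply: statesP => a b d k l y.
apply: (@central_state0 _ _ (ket_coef s G)) => //.
- by move=> *; rewrite XE ket_sum_nat.
- by move=> *; apply: (@ket_sum_neq0 _ s G); rewrite -XE; eassumption.
Qed.

Lemma mulZ_inj x : Z * x = 0 -> x = 0.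
Proof.
move=> Zx; apply: orbit_eq0; apply: statesP => a b d k l y.
have : orbit (Z * x) a b (d + 1) k l y = 0 by rewrite Zx /orbit rmorph0.
by rewrite orbitM phiZ regzE addrK.
Qed.

Lemma orbit_mon i j d y : orbit (C ^+ i * Z ^+ j) 0 0 d 0 0 y
  = if d == (i + j)%:R then ((y + 1) * (y + 2)) ^+ i else 0.
Proof.
have eqS (x : K) n : (x - 1 == n%:R) = (x == n.+1%:R) by rewrite subr_eq natr1.
elim: i d => [|i IH] d.
  rewrite mul1r add0n; elim: j d => [|j IH] d.
    by rewrite /orbit rmorph1 opE /vacuum !eqxx /= !andbT mulrb.
  by rewrite exprS orbitM phiZ regzE IH eqS.
rewrite exprS -mulrA orbitM lrmorph_casimir phiE phiH phiF phiP phiQ phiZ.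
rewrite hc_casimir; last exact: orbit_neg.
by rewrite IH eqS addSn; case: ifP => _; rewrite ?mulr0 // exprS.
Qed.

Lemma generators_central c : GRing.comm c E -> GRing.comm c F ->
  GRing.comm c P -> forall x, GRing.comm c x.
Proof.
move=> cE cF cP; apply: A_ind => [|a x y|g gin x cx]; first exact: commr1.
  exact: comm_comb.
exact: (commrM (comm_generators rel cE cF cP gin) cx).
Qed.

Lemma central_casimir x : GRing.comm C x.
Proof.
apply: generators_central; apply: esym;
  [exact: casimirCE | exact: casimirCF | exact: casimirCP].
Qed.

Lemma central_Z x : GRing.comm Z x.
Proof. by have [_ _ [ZE _ ZF ZP _]] := rel; apply: generators_central. Qed.

Lemma orbit_shift M x d y :
  orbit (Z ^+ M * x) 0 0 d 0 0 y = orbit x 0 0 (d - M%:R) 0 0 y.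
Proof.
elim: M d => [|M IH] d; first by rewrite mul1r subr0.
rewrite exprS -mulrA orbitM phiZ regzE IH -natr1.
by congr (orbit _ _ _ _ _ _ _); ring.
Qed.

Lemma central_shift x : (forall y, GRing.comm x y) ->
  exists M, zc_gen Z C (Z ^+ M * x).
Proof.
move=> xc; have [xe xp xh] := central_orbit xc.
have [s [G [us _ XE]]] := orbit_ket_sum x; have [N GN] := ket_coef_fin s G.
have Xnat a b d k l y : orbit x a%:R b%:R d%:R k%:R l%:R y =
    (ket_coef s G (a, b, d, k, l)).[y] by rewrite XE ket_sum_nat.
pose chi d := ket_coef s G (0, 0, d, 0, 0)%N.
have chi_sym d y : (chi d).[y] = (chi d).[- 3 - y].
  rewrite /chi -!Xnat (@leading_symmetric _ _ (ket_coef s G) N _ _ _ _ _ 0) //.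
    by congr (orbit x _ _ _ _ _ _); ring.
  by move=> *; apply: (@ket_sum_neq0 _ s G); rewrite -XE; eassumption.
have [S SE] := choice (fun d => poly_symmetric (chi_sym d)).
(* The term T^i z^d of the projection should come from C^i Z^(d-i), which may need a negative
   exponent. Multiplying by Z^M cures this: i < size (S d) <= M, so the subtraction in [Yd] is
   exact. *)
pose M := \sum_(d < N) size (S d).
pose Yd d := \sum_(i < size (S d)) (S d)`_i *: (C ^+ i * Z ^+ (d + M - i)).
pose Y := \sum_(d < N) Yd d.
have Ygen : zc_gen Z C Y.
  by do 2![apply: zc_gen_sum => ?]; apply/zc_genZ/zc_gen_mon/central_Z.
exists M; suff -> : Z ^+ M * x = Y by [].
(* The difference is central, so only its coefficients with a = b = k = l = 0 need to be
   compared. *)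
apply/eqP; rewrite -subr_eq0; apply/eqP; apply: central_orbit0 => [y|d y].
  apply/commr_sym/commrB.
    by apply: commrM; [apply/commrX/commr_sym/central_Z | apply/commr_sym/xc].
  do 2![apply: commr_sum => ? _]; rewrite -mulr_algl; apply: commrM.
    by rewrite /GRing.comm mulr_algl mulr_algr.
  by apply: commrM; apply/commrX/commr_sym;
    [apply: central_casimir | apply: central_Z].
rewrite orbitB !statesE orbit_shift orbit_sum states_sumE.
pose T := (y + 1) * (y + 2).
have TE : ((('X + 1) * ('X + 2)) : {poly K}).[y] = T.
  by rewrite /T -polyC1 -(polyC_natr K 2) !hornerE.
have YE (n : 'I_N) : orbit (Yd n) 0 0 d 0 0 y
    = if d == (n + M)%:R then (chi n).[y] else 0.
  rewrite orbit_sum states_sumE SE horner_comp TE horner_coef.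
  have Mn (i : 'I_(size (S n))) : (i + (n + M - i))%N = (n + M)%N.
    rewrite subnKC // (leq_trans (ltnW (ltn_ord i))) //.
    by rewrite (leq_trans _ (leq_addl _ _)) // /M (bigD1 n) //= leq_addr.
  case: ifP => dE.
    by apply: eq_bigr => i _; rewrite orbitZ statesE orbit_mon Mn dE.
  by rewrite big1 // => i _; rewrite orbitZ statesE orbit_mon Mn dE mulr0.
rewrite (eq_bigr _ (fun n _ => YE n)).
have dn (n : nat) : (d == (n + M)%:R) = (d - M%:R == n%:R).
  by rewrite natrD subr_eq.
have [X0|Xn0] := eqVneq (orbit x 0 0 (d - M%:R) 0 0 y) 0.
  rewrite X0 sub0r big1 ?oppr0 // => n _; case: ifP => //.
  rewrite dn => /eqP dE.
  by move: X0; rewrite dE (Xnat 0 0 n 0 0)%N.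
have /ket_sum_neq0[_ _ [n dE] _ _] : ket_sum s G 0 0 (d - M%:R) 0 0 y != 0.
  by rewrite -XE.
move: Xn0; rewrite dE (Xnat 0 0 n 0 0)%N -/(chi n) => chin.
have nN : (n < N)%N.
  rewrite ltnNge; apply: contra chin => Nn; rewrite /chi GN ?Nn ?orbT //.
  by rewrite horner0.
rewrite (bigD1 (Ordinal nN)) //= dn dE eqxx big1 ?addr0 ?subrr // => m mn.
by rewrite dn dE eqr_nat eq_sym; move: mn; rewrite -val_eqE /= => /negPf->.
Qed.

Lemma psi_casimir :
  psi C = casimir (nulle K) (nullh K) (nullf K) (nullp K) (nullq K) 0.
Proof.
  by rewrite lrmorph_casimir psiE psiH psiF psiP psiQ psiZ.
Qed.

Lemma psi_horner (g' : {poly K}) (F' : states K) a b d k l y :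
    (horner_alg (psi C) g' : op) F' a b d k l y
    = g'.[- 2 * d] * F' a b d k l y.
Proof.
  elim/poly_ind: g' F' => [|g' t IH] F'.
    by rewrite rmorph0 horner0 mul0r.
  have -> : horner_alg (psi C) (g' * 'X + t%:P)
      = horner_alg (psi C) g' * psi C + t%:A :> op.
    by rewrite rmorphD rmorphM /= horner_algX horner_algC.
  rewrite opE opE statesE IH psi_casimir null_casimir opE opE statesE.
  rewrite hornerD hornerM hornerX hornerC.
  by ring.
Qed.

Lemma psiZM u : psi (Z * u) = 0.
Proof. by rewrite rmorphM /= psiZ mul0r. Qed.

Lemma divisible_by_Z x u (g : {poly K}) :
  Z * x = horner_alg C g + Z * u -> g = 0.
Proof.
move=> zx; apply: poly_fun0 => y; pose one : states K := fun _ _ _ _ _ _ => 1.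
have psi0 : psi (horner_alg C g) = 0.
  by have := psiZM x; rewrite zx rmorphD /= psiZM addr0.
(* At index t = -y/2 the Casimir acts by -2t = y, so g(y) = 0 for each y. *)
have := psi_horner g one 0 0 (- y / 2) 0 0 0.
rewrite -lrmorph_horner_alg psi0 mulr1 => /esym.
have -> : - 2 * (- y / 2) = y by field.
by [].
Qed.

Lemma descent x : zc_gen Z C (Z * x) -> zc_gen Z C x.
Proof.
move=> [[|g s] /= zx]; first by rewrite (mulZ_inj zx); apply: zc_gen0.
exists s; apply/eqP; rewrite -subr_eq0; apply/eqP/mulZ_inj.
by rewrite mulrBr zx (divisible_by_Z zx) rmorph0 add0r subrr.
Qed.

Lemma central_zc_gen x : (forall y, GRing.comm x y) -> zc_gen Z C x.
Proof.
move=> /central_shift[M]; elim: M x => [|M IH] x; first by rewrite mul1r.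
by rewrite exprSr -mulrA => /IH/descent.
Qed.

End Center.

(** * The enveloping algebra *)

Lemma comb6_mull (K : fieldType) (A : algType K) (P : A -> Prop)
    (g0 g1 g2 g3 g4 g5 u : A) (c0 c1 c2 c3 c4 c5 : K) :
    P 0 -> (forall c x y, P x -> P y -> P (c *: x + y)) ->
    (forall g, g \in [:: g0; g1; g2; g3; g4; g5] -> P (g * u)) ->
  P ((c0 *: g0 + c1 *: g1 + c2 *: g2 + c3 *: g3 + c4 *: g4 + c5 *: g5) * u).
Proof.
move=> P0 PD Pg; rewrite !mulrDl -!scalerAl -!addrA.
do 5![apply: (PD); first by apply: Pg; rewrite ?inE ?eqxx ?orbT].
by rewrite -[_ *: _]addr0; apply: PD => //; apply: Pg; rewrite ?inE ?eqxx ?orbT.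
Qed.

Section EnvelopingSchrodinger.
Variable K : numFieldType.
Local Notation U := (env_alg (schrodinger K)).
Local Notation e := (env_inj (sch_e K) : U).
Local Notation h := (env_inj (sch_h K) : U).
Local Notation f := (env_inj (sch_f K) : U).
Local Notation p := (env_inj (sch_p K) : U).
Local Notation q := (env_inj (sch_q K) : U).
Local Notation z := (env_inj (sch_z K) : U).

Lemma env_inj_basis (x : schrodinger K) : (env_inj x : U) =
  x 0 (inord 0) *: e + x 0 (inord 1) *: h + x 0 (inord 2) *: f
  + x 0 (inord 3) *: p + x 0 (inord 4) *: q + x 0 (inord 5) *: z.
Proof.
have lin c (u v : schrodinger K) :
    (env_inj (c *: u + v) : U) = c *: env_inj u + env_inj v.
  exact: env_inj_linear.
have lin0 : (env_inj (0 : schrodinger K) : U) = 0 by apply: linear0.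
have {1}-> : x = x 0 (inord 0) *: sch_e K + (x 0 (inord 1) *: sch_h K
  + (x 0 (inord 2) *: sch_f K + (x 0 (inord 3) *: sch_p K
  + (x 0 (inord 4) *: sch_q K + (x 0 (inord 5) *: sch_z K + 0))))).
  by rewrite addr0 !addrA; apply: etrans (row_sum_delta x) (sum_ord6 _).
rewrite -!addrA; do 5![apply: etrans (lin _ _ _) _; congr (_ + _)].
by apply: etrans (lin _ _ _) _; rewrite lin0 addr0.
Qed.

(** Elements of U are combinations of words by [env_pi_sum]; a word grows by left multiplication by
    some [env_inj x], which is expanded in the six basis vectors. *)
Lemma env_ind (P : U -> Prop) : P 1 ->
    (forall c x y, P x -> P y -> P (c *: x + y)) ->
    (forall g, g \in [:: e; h; f; p; q; z] -> forall x, P x -> P (g * x)) ->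
  forall x, P x.
Proof.
move=> P1 PD PM.
have P0 : P 0 by rewrite -(addNr 1) -scaleN1r; apply: PD.
have PX x (u : U) : P u -> P (env_inj x * u).
  move=> Pu; rewrite (env_inj_basis x); apply: comb6_mull => // g gin.
  exact: PM.
elim/env_pi_ind => u; rewrite env_pi_sum.
elim: (enum_fset (msupp u)) => [|m s IH]; first by rewrite big_nil.
rewrite big_cons; apply: PD => //.
by elim: (m : seq _) => [|x t IHt]; rewrite ?big_nil ?big_cons //; apply: PX.
Qed.

Let brk (x y w : schrodinger K) : lie x y = w ->
  (env_inj x : U) * env_inj y = env_inj y * env_inj x + env_inj w.
Proof. by move=> <-; rewrite env_inj_lie addrC subrK. Qed.

Lemma env_relations : sch_relations e h f p q z.
Proof.
have [[he ef hf pq] [eq ep hp] [fp fq hq] zc] := sch_brackets K.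
have inj0 : env_inj (0 : schrodinger K) = 0 :> U.
  exact: (linear0 (@env_inj K (schrodinger K))).
have brkZ c (x y w : schrodinger K) : lie x y = c *: w ->
    (env_inj x : U) * env_inj y = env_inj y * env_inj x + c *: env_inj w.
  move=> /brk ->; congr (_ + _); apply: etrans (_ : env_inj (c *: w + 0) = _).
    by rewrite [c *: w + 0]addr0.
  by apply: etrans (env_inj_linear c w 0) _; rewrite inj0 addr0.
have brk0 (x y : schrodinger K) : lie x y = 0 ->
    (env_inj x : U) * env_inj y = env_inj y * env_inj x.
  by move=> /brk ->; rewrite inj0 addr0.
split; split; try by [exact: brk | exact: brkZ | exact: brk0].
  by apply: etrans (brkZ _ _ _ _ hf) _; rewrite scaleNr.
have hq' : lie (sch_h K) (sch_q K) = (-1) *: sch_q K by rewrite scaleN1r.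
by apply: etrans (brkZ _ _ _ _ hq') _; rewrite scaleN1r.
Qed.

End EnvelopingSchrodinger.

(** * The center as a generated subalgebra *)

Section GeneratedSubalgebra.
Local Open Scope classical_set_scope.

Lemma alg_center_subalg (K : fieldType) (A : algType K) :
  GRing.subalg_closed (mem (alg_center A)).
Proof.
split=> [|a u v /set_mem uC /set_mem vC|u v /set_mem uC /set_mem vC].
- by apply/mem_set => y; rewrite mul1r mulr1.
- apply/mem_set => y.
  by rewrite mulrDl mulrDr -scalerAl -scalerAr (uC y) (vC y).
by apply/mem_set => y; rewrite -mulrA (vC y) mulrA (uC y) mulrA.
Qed.

Lemma alg_center_gen (K : fieldType) (A : algType K) (z c : A) :
    (forall x, GRing.comm z x) -> (forall x, GRing.comm c x) ->
    (forall x, (forall y, GRing.comm x y) -> zc_gen z c x) ->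
  alg_center A = gen_subalg [set z; c].
Proof.
move=> zC cC gen; apply/seteqP; split=> [x xC B [Bcl SB]|].
  have Bz : z \in mem B by apply/mem_set/SB; left.
  have Bc : c \in mem B by apply/mem_set/SB; right.
  exact: (set_mem (zc_gen_subalg Bcl Bz Bc (gen x xC))).
apply: smallest_sub; first exact: alg_center_subalg.
by move=> _ [->|->].
Qed.

End GeneratedSubalgebra.

Section Main.
Local Open Scope classical_set_scope.

Lemma center_schrodinger (K : numFieldType) :
  alg_center (env_alg (schrodinger K))
  = gen_subalg [set env_inj (sch_z K); sch_c K].
Proof.
have rel := env_relations K; have ind := @env_ind K.
have [phi [pe ph pf [pp pq pz]]] := reg_exists K.
have [psi [se sh sf [sp sq sz]]] := null_exists K.
apply: alg_center_gen.
- exact: (central_Z rel ind).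
(* [sch_c] unfolds to [casimir] of the six generators of U. *)
- exact: (central_casimir rel ind).
exact: (central_zc_gen rel ind pe ph pf pp pq pz se sh sf sp sq sz).
Qed.

End Main.

Local Open Scope complex_scope.
Local Open Scope classical_set_scope.

Theorem corollary18 (R : realType) :
  alg_center (env_alg (schrodinger R[i]))
  = gen_subalg [set env_inj (sch_z R[i]); sch_c R[i]].
Proof. exact: center_schrodinger. Qed.
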